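(* Let $f:\mathbb{R}^d\to\mathbb{R}$ be of class $C^2$, and consider the normalized gradient descent (NGD) differential equation $$\dot{\mathbf{x}} = -\frac{\nabla f(\mathbf{x})}{\|\nabla f(\mathbf{x})\|}.$$ (i) Let $x^*$ be a saddle point of $f$ such that there exists an eigenvalue $\lambda$ of the Hessian $D^2 f(x^* )$ with $\lambda<0$. Then solutions of the NGD equation can only reach or converge to $x^*$ from a set of initial conditions with Lebesgue measure zero. (ii) Suppose that each saddle point of $f$ is non-degenerate. Then the set of initial conditions from which solutions of the NGD equation reach or converge to a saddle point of $f$ has Lebesgue measure zero.
   Context: $\|\cdot\|$ is the Euclidean norm and Lebesgue measure is $d$-dimensional Lebesgue measure on $\mathbb{R}^d$. A saddle point of $f$ is a critical point of $f$ that is neither a local minimum nor a local maximum; it is non-degenerate if the Hessian $D^2 f(x^* )$ is non-singular. Solutions are classical: a solution of the NGD equation with initial condition $x_0$ (where $\nabla f(x_0)\neq 0$) is a $C^1$ curve $\mathbf{x}$ on an interval $[0,T)$, $0<T\le\infty$, with $\mathbf{x}(0)=x_0$, satisfying the equation at all $t\in[0,T)$ (in particular not meeting critical points of $f$ on $[0,T)$). ''The solution'' means the unique one defined on its maximal interval of existence $[0,T)$, with $T$ depending on $x_0$. Such a solution reaches or converges to $x^*$ if $\mathbf{x}(t)\to x^*$ as $t\to T$ (''reaches'' being the case $T<\infty$). *)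

(* Defs.v *)
(* MathComp-Analysis; R^d is 'rV[R]_d with R : realType. *)
From HB Require Import structures.
From mathcomp Require Import all_boot all_order all_algebra.
From mathcomp Require Import all_classical all_reals all_analysis.

Set Implicit Arguments.
Unset Strict Implicit.
Unset Printing Implicit Defensive.

Import Order.TTheory GRing.Theory Num.Theory.
Import numFieldNormedType.Exports.

Local Open Scope classical_set_scope.
Local Open Scope ring_scope.

(* The library norm `|v| on 'rV[R]_d is the sup norm, so the Euclidean norm is
   defined here; both induce the same topology. *)
Definition enorm (R : realType) (d : nat) (v : 'rV[R]_d) : R :=
  Num.sqrt (\sum_(i < d) v 0 i ^+ 2).

Definition partial (R : realType) (d : nat) (i : 'I_d) (f : 'rV[R]_d -> R)
  (x : 'rV[R]_d) : R := 'D_(delta_mx 0 i) f x.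

Definition gradient (R : realType) (d : nat) (f : 'rV[R]_d -> R)
  (x : 'rV[R]_d) : 'rV[R]_d := \row_i partial i f x.

Definition hessian (R : realType) (d : nat) (f : 'rV[R]_d -> R)
  (x : 'rV[R]_d) : 'M[R]_d := \matrix_(i, j) partial i (partial j f) x.

(* In finite dimension, continuity of x |-> 'd f x amounts to continuity of all
   partial derivatives. *)
Definition classC1 (R : realType) (d : nat) (f : 'rV[R]_d -> R) : Prop :=
  (forall x, differentiable f x) /\ (forall i, continuous (partial i f)).

Definition classC2 (R : realType) (d : nat) (f : 'rV[R]_d -> R) : Prop :=
  classC1 f /\ (forall i, classC1 (partial i f)).

Definition local_min (R : realType) (d : nat) (f : 'rV[R]_d -> R)
  (x : 'rV[R]_d) : Prop := \forall y \near x, f x <= f y.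

Definition local_max (R : realType) (d : nat) (f : 'rV[R]_d -> R)
  (x : 'rV[R]_d) : Prop := \forall y \near x, f y <= f x.

Definition critical (R : realType) (d : nat) (f : 'rV[R]_d -> R)
  (x : 'rV[R]_d) : Prop := gradient f x = 0.

Definition saddle (R : realType) (d : nat) (f : 'rV[R]_d -> R)
  (x : 'rV[R]_d) : Prop :=
  [/\ critical f x, ~ local_min f x & ~ local_max f x].

Definition nondegenerate_at (R : realType) (d : nat) (f : 'rV[R]_d -> R)
  (x : 'rV[R]_d) : Prop := hessian f x \in unitmx.

(* The interval [0, T) with 0 < T <= +oo. *)
Definition lifespan (R : realType) (T : \bar R) : set R :=
  [set t | 0 <= t /\ (t%:E < T)%E].

(* One-sided at the points of I that are endpoints of I. *)
Definition has_derivative_within (R : realType) (d : nat) (I : set R)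
  (x : R -> 'rV[R]_d) (t : R) (v : 'rV[R]_d) : Prop :=
  (fun s => (s - t)^-1 *: (x s - x t)) @ within I t^' --> v.

(* Curves are total functions on R; only their values on [0, T) matter. *)
Definition ngd_solution (R : realType) (d : nat) (f : 'rV[R]_d -> R)
  (x0 : 'rV[R]_d) (T : \bar R) (x : R -> 'rV[R]_d) : Prop :=
  [/\ (0 < T)%E, x 0 = x0 &
    exists dx : R -> 'rV[R]_d,
      {within lifespan T, continuous dx} /\
      forall t, lifespan T t ->
        [/\ has_derivative_within (lifespan T) x t (dx t),
            gradient f (x t) != 0 &
            dx t = - ((enorm (gradient f (x t)))^-1 *: gradient f (x t))]].

Definition maximal_ngd_solution (R : realType) (d : nat) (f : 'rV[R]_d -> R)
  (x0 : 'rV[R]_d) (T : \bar R) (x : R -> 'rV[R]_d) : Prop :=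
  ngd_solution f x0 T x /\
  forall (T' : \bar R) (y : R -> 'rV[R]_d), (T <= T')%E ->
    ngd_solution f x0 T' y -> (forall t, lifespan T t -> y t = x t) -> T' = T.

(* The filter of "t -> T with t < T"; the case T = -oo is a dummy. *)
Definition to_end (R : realType) (T : \bar R) : set_system R :=
  match T with
  | r%:E => at_left r
  | +oo => pinfty_nbhs R
  | -oo => ninfty_nbhs R
  end%E.

Definition reaching_set (R : realType) (d : nat) (f : 'rV[R]_d -> R)
  (xstar : 'rV[R]_d) : set 'rV[R]_d :=
  [set x0 | exists (T : \bar R) (x : R -> 'rV[R]_d),
     maximal_ngd_solution f x0 T x /\ x @ to_end T --> xstar].

Definition box (R : realType) (d : nat) (a b : 'rV[R]_d) : set 'rV[R]_d :=
  [set x | forall i, a 0 i < x 0 i <= b 0 i].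

(* d-dimensional Lebesgue outer measure: infimum of the total volumes of the
   coverings by countably many boxes. The index set P allows finite and empty
   coverings, so that the empty set has measure 0 also when d = 0. *)
Definition lebesgue_outer (R : realType) (d : nat) (A : set 'rV[R]_d) : \bar R :=
  ereal_inf [set l : \bar R |
    exists (P : pred nat) (a b : nat -> 'rV[R]_d),
      [/\ forall k i, a k 0 i <= b k 0 i,
          A `<=` \bigcup_(k in [set` P]) box (a k) (b k) &
          l = (\sum_(0 <= k <oo | P k)
                 (\prod_(i < d) (b k 0 i - a k 0 i))%:E)%E]].

(* A set is Lebesgue measurable of measure 0 iff its outer measure is 0. *)
Definition lebesgue_null (R : realType) (d : nat) (A : set 'rV[R]_d) : Prop :=
  lebesgue_outer A = 0%E.

(* Main.v *)
(** After the time change ds = dt / |grad f(x)|, a solution converging to a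
    critical point becomes an ordinary gradient descent curve on [0, +oo[.  Let
    H be the Hessian at a critical point c, with v H v^T < 0, and choose a > 0
    such that v (H + a) v^T < 0 and H + a is invertible.  If x and y are descent
    curves that remain close to c, then g = (x - y) (H + a) (x - y)^T satisfies
    g' <= 2 a g; since g is bounded it cannot be negative.  Hence, at a time
    after which they stay near c, the differences of any two such curves avoid
    an open cone around v, i.e. their positions form a Lipschitz graph over a
    hyperplane, which is null.  No stable manifold is constructed and H may be
    degenerate.  By Gronwall's inequality run backwards the initial points
    depend in a Lipschitz way on these positions, so that they form a null set
    too.  This null set consists of all points whose curves are eventually in a
    fixed ball around c, which makes it possible to treat all saddles at once
    with countably many balls.  A nondegenerate saddle admits such a v, since an
    invertible positive semidefinite Hessian is definite and yields a minimum. *)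
Require Import Defs.
From HB Require Import structures.
From mathcomp Require Import all_boot all_order all_algebra.
From mathcomp Require Import all_classical all_reals all_analysis.
From mathcomp Require Import ring lra zify.

Set Implicit Arguments.
Unset Strict Implicit.
Unset Printing Implicit Defensive.

Import Order.TTheory GRing.Theory Num.Theory.
Import numFieldNormedType.Exports.

Local Open Scope classical_set_scope.
Local Open Scope ring_scope.

(** * Null sets *)

Lemma lebesgue_outer_ge0 (R : realType) (d : nat) (A : set 'rV[R]_d) :
  (0 <= lebesgue_outer A)%E.
Proof.
apply: le_ereal_inf_tmp => _ [P [a [b [ab _ ->]]]].
apply: nneseries_ge0 => k _ _; rewrite lee_fin; apply: prodr_ge0 => i _.
by rewrite subr_ge0.
Qed.

Lemma lebesgue_nullP (R : realType) (d : nat) (A : set 'rV[R]_d) :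
  lebesgue_null A <-> forall e : R, 0 < e ->
    exists (P : pred nat) (a b : nat -> 'rV[R]_d),
      [/\ forall k i, a k 0 i <= b k 0 i,
          A `<=` \bigcup_(k in [set` P]) box (a k) (b k) &
          (\sum_(0 <= k <oo | P k)
             (\prod_(i < d) (b k 0 i - a k 0 i))%:E <= e%:E)%E].
Proof.
split=> [A0 e e0|H].
  have : (lebesgue_outer A < e%:E)%E by rewrite A0 lte_fin.
  move=> /ereal_inf_lt[_ [P [a [b [ab Ab ->]]]] /ltW le].
  by exists P, a, b; split.
apply/eqP; rewrite eq_le lebesgue_outer_ge0 andbT.
apply/lee_addgt0Pr => e e0; rewrite add0e.
have [P [a [b [ab Ab le]]]] := H e e0.
by apply: ge_ereal_inf; eexists; last exact: le; exists P, a, b; split.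
Qed.

Lemma lebesgue_null_sub (R : realType) (d : nat) (A B : set 'rV[R]_d) :
  A `<=` B -> lebesgue_null B -> lebesgue_null A.
Proof.
move=> AB /lebesgue_nullP B0; apply/lebesgue_nullP => e /B0[P [a [b [? Bb ?]]]].
by exists P, a, b; split=> //; exact: subset_trans Bb.
Qed.

(** Covering the n-th set up to volume [e / 2^(n+1)] keeps the total below [e]; a bijection of nat
    with pairs merges all the coverings into one sequence. *)
Lemma lebesgue_null_bigcup (R : realType) (d : nat)
    (A : nat -> set 'rV[R]_d) :
  (forall n, lebesgue_null (A n)) -> lebesgue_null (\bigcup_n A n).
Proof.
move=> A0; apply/lebesgue_nullP => e e0.
have en0 n : 0 < e / (2 ^ n.+1)%:R by rewrite divr_gt0// ltr0n expn_gt0.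
have /choice[c hc] : forall n, exists c : pred nat * (nat -> 'rV[R]_d) * (nat -> 'rV[R]_d),
    [/\ forall k i, c.1.2 k 0 i <= c.2 k 0 i,
        A n `<=` \bigcup_(k in [set` c.1.1]) box (c.1.2 k) (c.2 k) &
        (\sum_(0 <= k <oo | c.1.1 k)
           (\prod_(i < d) (c.2 k 0 i - c.1.2 k 0 i))%:E
         <= (e / (2 ^ n.+1)%:R)%:E)%E].
  move=> n; have /lebesgue_nullP/(_ _ (en0 n))[P [a [b h]]] := A0 n.
  by exists (P, a, b).
have vol_ge0 n k : (0 <= (\prod_(i < d) ((c n).2 k 0 i - (c n).1.2 k 0 i))%:E)%E.
  rewrite lee_fin; apply: prodr_ge0 => i _.
  by have [ab _ _] := hc n; rewrite subr_ge0.
have /card_set_bijP[u [_ uinj usurj]] :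
  ([set: nat] #= [set: nat * nat])%card := card_esym card_nat2.
exists (fun k => (c (u k).1).1.1 (u k).2), (fun k => (c (u k).1).1.2 (u k).2),
  (fun k => (c (u k).1).2 (u k).2); split.
- by move=> k i; have [+ _ _] := hc (u k).1; apply.
- move=> x [n _ Anx]; have [_ /(_ x Anx)[j /= Pj xj] _] := hc n.
  have [k _ uk] := usurj (n, j) I.
  by exists k; [change (is_true ((c (u k).1).1.1 (u k).2))|]; rewrite uk.
- rewrite nneseries_esum; last by move=> k _.
  pose V (p : nat * nat) : \bar R :=
    (\prod_(i < d) ((c p.1).2 p.2 0 i - (c p.1).1.2 p.2 0 i))%:E.
  rewrite -(@reindex_esum _ _ _ _
    ([set: nat] `*`` (fun n => [set j | (c n).1.1 j])) u V); last first.
    split.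
    + by move=> k /= Pk; split.
    + by move=> k l _ _; apply: uinj; rewrite inE.
    + by move=> p [_ /= Pp]; have [k _ uk] := usurj p I; exists k => //=; rewrite uk.
  rewrite -(@esum_esum _ _ _ _ _ (fun n k => V (n, k))); last first.
    by move=> n k _ _; exact: vol_ge0.
  apply: le_trans (epsilon_trick0 xpredT (ltW e0)).
  rewrite nneseries_esumT; last by move=> n; rewrite lee_fin ltW.
  apply: le_esum => n _; have [_ _] := hc n; apply: le_trans.
  by rewrite -nneseries_esum // => k _; exact: vol_ge0.
Qed.

Lemma rV_norm_le (R : realType) (d : nat) (v : 'rV[R]_d) (r : R) :
  0 <= r -> (forall i, `|v 0 i| <= r) -> `|v| <= r.
Proof.
move=> r0 h; rewrite [`|v|]mx_normrE; apply: bigmax_le => // -[i j] _ /=.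
by rewrite ord1.
Qed.

Lemma rV_coord_le (R : realType) (d : nat) (v : 'rV[R]_d) (i : 'I_d) :
  `|v 0 i| <= `|v|.
Proof.
rewrite [`|v|]mx_normrE.
exact: (le_bigmax _ (fun ij => `|v ij.1 ij.2|) (0, i)).
Qed.

Lemma nneseries_ltn_const (R : realType) (M : nat) (V : R) : 0 <= V ->
  (\sum_(0 <= k <oo | (k < M)%N) V%:E <= (M%:R * V)%:E)%E.
Proof.
move=> V0; apply: lime_le.
  by apply: is_cvg_nneseries_cond => n _ _; rewrite lee_fin.
apply: nearW => n; rewrite sumEFin lee_fin.
have -> : \sum_(0 <= k < n | (k < M)%N) V = (minn n M)%:R * V.
  elim: n => [|n IH]; first by rewrite big_nil min0n mul0r.
  rewrite big_mkcond big_nat_recr//= -big_mkcond/= IH.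
  case: ltnP => nM; last by rewrite addr0; congr (_%:R * _); lia.
  have -> : minn n.+1 M = (minn n M).+1 by lia.
  by rewrite -natr1 mulrDl mul1r (minn_idPl (ltnW nM)).
by rewrite ler_wpM2r// ler_nat geq_minr.
Qed.

(* Dividing the bounded image of rho into (N+1)^m cubes of side O(1/N) yields a
   covering of A by (N+1)^m boxes of side O(1/N) in dimension m+1. *)
Lemma lebesgue_null_chart (R : realType) (m : nat) (A : set 'rV[R]_m.+1)
    (rho : 'rV[R]_m.+1 -> 'rV[R]_m) (K C : R) :
  (forall x, A x -> `|rho x| <= K) ->
  (forall x y, A x -> A y -> `|x - y| <= C * `|rho x - rho y|) ->
  lebesgue_null A.
Proof.
wlog [K0 C0] : K C / 0 < K /\ 0 < C.
  move=> W rhoK rhoC; apply: (W (Num.max K 1) (Num.max C 1)).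
  - by rewrite !lt_max ltr01 !orbT.
  - by move=> x /rhoK; rewrite le_max => ->.
  - move=> x y Ax Ay; apply: le_trans (rhoC _ _ Ax Ay) _.
    by rewrite ler_wpM2r// le_max lexx.
move=> rhoK rhoC; apply/lebesgue_nullP => e e0.
(* The boxes built below have total volume at most [Q / N], hence the choice of [N] larger than
   [Q / e]. *)
pose Q := 2 ^+ m * (8 * C * K) ^+ m.+1.
pose N := (Num.truncn (Q / e)).+1.
have N0 : 0 < N%:R :> R by rewrite ltr0n.
have QN : Q / N%:R <= e.
  rewrite ler_pdivrMr// mulrC -ler_pdivrMr// ltW// /N.
  exact: truncnS_gt.
pose w := 2 * K / N%:R.
have w0 : 0 < w by rewrite divr_gt0// mulr_gt0.
pose idx (x : 'rV[R]_m.+1) (j : 'I_m) := Num.truncn ((rho x 0 j + K) / w).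
have idx_range x j : A x -> 0 <= (rho x 0 j + K) / w <= N%:R.
  move=> /rhoK rK; have := le_trans (rV_coord_le (rho x) j) rK.
  rewrite ler_norml => /andP[r1 r2]; apply/andP; split.
    by rewrite divr_ge0 ?(ltW w0)//; lra.
  rewrite ler_pdivrMr// /w mulrC divfK ?gt_eqF//; lra.
(* An index equals [N] when a coordinate of [rho x] is exactly [K], hence [N.+1] values per
   coordinate. *)
pose cell x : {ffun 'I_m -> 'I_N.+1} := [ffun j => inord (idx x j)].
have idx_lt x j : A x -> (idx x j < N.+1)%N.
  move=> Ax; have /andP[r1 r2] := idx_range x j Ax.
  by rewrite ltnS /idx truncn_le_nat (le_lt_trans r2)// ltr_nat.
have cell_eq x y : A x -> A y -> cell x = cell y -> `|x - y| <= C * w.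
  move=> Ax Ay xy; apply: le_trans (rhoC _ _ Ax Ay) _.
  rewrite ler_wpM2l ?(ltW C0)//; apply: rV_norm_le; first exact: ltW.
  move=> j.
  have := congr1 (fun c : {ffun 'I_m -> 'I_N.+1} => nat_of_ord (c j)) xy.
  rewrite !ffunE !inordK ?idx_lt// => ij.
  have /andP[/truncn_itv/andP[x1 x2] _] := idx_range x j Ax.
  have /andP[/truncn_itv/andP[y1 y2] _] := idx_range y j Ay.
  rewrite -/(idx x j) -/(idx y j) -ij -natr1 in x1 x2 y1 y2.
  rewrite ler_pdivlMr// in x1; rewrite ltr_pdivrMr// in x2.
  rewrite ler_pdivlMr// in y1; rewrite ltr_pdivrMr// in y2.
  rewrite !mxE ler_norml; lra.
(* A representative in [A] of the cell [c]. For an empty cell [get] returns a default point, whose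
   box only enters the volume count. *)
pose ctr c := get [set x | A x /\ cell x = c].
pose F : finType := {ffun 'I_m -> 'I_N.+1}.
pose pt k := ctr (nth (cell 0) (enum F) k).
have Cw0 : 0 < C * w by rewrite mulr_gt0.
(* Boxes are open on the left, so the half side [2 * (C * w)] is taken strictly above the distance
   bound [C * w]. *)
exists (fun k => (k < #|F|)%N),
  (fun k => pt k - const_mx (2 * (C * w))), (fun k => pt k + const_mx (2 * (C * w))).
split.
- by move=> k i; rewrite !mxE; lra.
- move=> x Ax; exists (index (cell x) (enum F)).
    change (is_true (index (cell x) (enum F) < #|F|)%N).
    by rewrite cardE index_mem mem_enum.
  move=> i; have [Ac cc] : [set y | A y /\ cell y = cell x] (ctr (cell x)).
    by apply: (@getI _ _ x).
  rewrite /pt nth_index ?mem_enum// !mxE.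
  have := cell_eq _ _ Ax Ac (esym cc).
  move=> /(le_trans (rV_coord_le _ i)); rewrite !mxE ler_norml => /andP[z1 z2].
  by apply/andP; split; lra.
- have vol k : \prod_(i < m.+1) ((pt k + const_mx (2 * (C * w))) 0 i -
      (pt k - const_mx (2 * (C * w))) 0 i) = (4 * (C * w)) ^+ m.+1.
    rewrite (eq_bigr (fun=> 4 * (C * w))) ?prodr_const ?card_ord// => i _.
    by rewrite !mxE; ring.
  under eq_eseriesr => k _ do rewrite vol.
  have V0 : 0 <= (4 * (C * w)) ^+ m.+1 by rewrite exprn_ge0//; lra.
  apply: le_trans (nneseries_ltn_const #|F| V0) _.
  rewrite lee_fin; apply: le_trans QN.
  rewrite card_ffun !card_ord natrX.
  have -> : 4 * (C * w) = (8 * C * K) / N%:R by rewrite /w; field; rewrite gt_eqF.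
  rewrite /Q expr_div_n [N%:R ^+ m.+1]exprSr.
  have NN : N.+1%:R ^+ m <= 2 ^+ m * N%:R ^+ m :> R.
    rewrite -exprMn lerXn2r ?nnegrE// -natrM ler_nat; lia.
  have -> : 2 ^+ m * (8 * C * K) ^+ m.+1 / N%:R =
    2 ^+ m * N%:R ^+ m * ((8 * C * K) ^+ m.+1 / (N%:R ^+ m * N%:R)).
    by field; rewrite expf_neq0 gt_eqF.
  rewrite ler_wpM2r // divr_ge0 // ?exprn_ge0 // ?mulr_ge0 ?exprn_ge0 // ?(ltW C0) ?(ltW K0) ?(ltW N0) //.
Qed.

(** * Mean value theorem and Gronwall's inequality *)

Lemma is_derive_line (R : realType) (d : nat) (g : 'rV[R]_d -> R)
    (y v : 'rV[R]_d) (t : R) : differentiable g (y + t *: v) ->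
  is_derive t 1 (fun s => g (y + s *: v))
    (\sum_i v 0 i * partial i g (y + t *: v)).
Proof.
move=> dg; set z := y + t *: v.
have eqf : (fun h : R => h^-1 *: (((fun s => g (y + s *: v)) \o shift t) (h *: 1)
              - g (y + t *: v))) =
           (fun h : R => h^-1 *: ((g \o shift z) (h *: v) - g z)).
  apply/funext => h /=; congr (_ *: (g _ - _)).
  by rewrite /z [_%:A]mulr1 scalerDl addrCA.
have dv : derivable g z v by exact: diff_derivable.
have Dv : 'D_v g z = \sum_i v 0 i * partial i g z.
  rewrite deriveE// [in LHS](row_sum_delta v) linear_sum; apply: eq_bigr => i _.
  by rewrite linearZ /partial deriveE.
by apply: DeriveDef; [rewrite /derivable eqf|rewrite /derive eqf -Dv].
Qed.

Lemma is_derive_continuous (R : realType) (W : normedModType R) (u : R -> W)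
    (t : R) (du : W) :
  is_derive t 1 u du -> {for t, continuous u}.
Proof. by move=> [/derivable1_diffP/differentiable_continuous]. Qed.

Lemma is_derive_segment_continuous (R : realType) (u du : R -> R) (a b : R) :
  (forall t, a <= t <= b -> is_derive t 1 u (du t)) ->
  {within `[a, b], continuous u}.
Proof.
move=> h; apply: derivable_within_continuous => t; rewrite in_itv/= => tab.
by have [] := h t tab.
Qed.

Lemma partial_mvt (R : realType) (d : nat) (g : 'rV[R]_d -> R) :
  (forall z, differentiable g z) -> forall x y, exists2 t, 0 <= t <= 1 &
  g x - g y = \sum_i (x - y) 0 i * partial i g (y + t *: (x - y)).
Proof.
move=> dg x y; pose dphi t := \sum_i (x - y) 0 i * partial i g (y + t *: (x - y)).
have h (t : R) : is_derive t 1 (fun s => g (y + s *: (x - y))) (dphi t).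
  exact: is_derive_line.
have [t] := @MVT_segment R _ dphi 0 1 ler01 (fun t _ => h t)
  (is_derive_segment_continuous (fun t _ => h t)).
rewrite in_itv/= scale1r scale0r addr0 subr0 mulr1 [y + (x - y)]addrC subrK.
by move=> t01 ->; exists t.
Qed.

Lemma ler_of_derive (R : realType) (u du : R -> R) (a b : R) : a <= b ->
  (forall t, a <= t <= b -> is_derive t 1 u (du t)) ->
  (forall t, a <= t <= b -> du t <= 0) -> u b <= u a.
Proof.
move=> ab hu du0.
have [t||t] := @MVT_segment R u du a b ab.
- by rewrite in_itv/= => /andP[a1 b1]; apply: hu; rewrite !ltW.
- exact: is_derive_segment_continuous hu.
rewrite in_itv/= => /du0 dut ub; rewrite -subr_le0 ub.
by rewrite mulr_le0_ge0// subr_ge0.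
Qed.

(** The product of [expR (- k)] and [u] is nonincreasing. The rate enters through its primitive [k],
    so it may vary with time. *)
Lemma gronwall (R : realType) (u du k dk : R -> R) (a b : R) : a <= b ->
  (forall t, a <= t <= b -> is_derive t 1 u (du t)) ->
  (forall t, a <= t <= b -> is_derive t 1 k (dk t)) ->
  (forall t, a <= t <= b -> du t <= dk t * u t) ->
  u b <= expR (k b - k a) * u a.
Proof.
move=> ab hu hk le.
have hw (t : R) : a <= t <= b -> is_derive t 1 (fun s => expR (- k s) * u s)
    (expR (- k t) * (du t - dk t * u t)).
  move=> tab; have := hu t tab; have := hk t tab => kt ut.
  have et : is_derive t 1 (expR \o (- k)) (expR (- k t) * - dk t).
    exact: is_derive1_comp.
  apply: is_derive_eq (@is_deriveM _ _ _ _ _ _ _ _ et ut) _.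
  by rewrite /GRing.scale/=; ring.
have := ler_of_derive ab hw _.
have H : forall t, a <= t <= b -> expR (- k t) * (du t - dk t * u t) <= 0.
  by move=> t tab; rewrite mulr_ge0_le0 ?expR_ge0// subr_le0 le.
move=> /(_ H); rewrite -(ler_pM2l (expR_gt0 (k b))) !mulrA -!expRD subrr expR0.
by rewrite mul1r.
Qed.

(** Gronwall's inequality for [- u] and [- k]: it controls the past value by the present one. *)
Lemma gronwall_ge (R : realType) (u du k dk : R -> R) (a b : R) : a <= b ->
  (forall t, a <= t <= b -> is_derive t 1 u (du t)) ->
  (forall t, a <= t <= b -> is_derive t 1 k (dk t)) ->
  (forall t, a <= t <= b -> - (dk t * u t) <= du t) ->
  u a <= expR (k b - k a) * u b.
Proof.
move=> ab hu hk le.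
have := @gronwall R (fun t => - u t) (fun t => - du t) (fun t => - k t)
  (fun t => - dk t) a b ab (fun t h => @is_deriveN _ _ _ _ _ _ _ (hu t h))
  (fun t h => @is_deriveN _ _ _ _ _ _ _ (hk t h)).
have H : forall t, a <= t <= b -> - du t <= - dk t * - u t.
  by move=> t h; have := le t h; lra.
move=> /(_ H); rewrite mulrN lerN2 -(ler_pM2l (expR_gt0 (k b - k a))) mulrA -expRD.
by rewrite opprK addrCA addrAC !addrA addNr add0r; rewrite (_ : _ + _ = 0) ?expR0 ?mul1r//; ring.
Qed.

(** * Second derivatives *)

Lemma sum_scale_delta (R : realType) (d : nat) (s : R) (i : 'I_d)
    (c : 'I_d -> R) :
  \sum_k (s *: delta_mx 0 i : 'rV[R]_d) 0 k * c k = s * c i.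
Proof.
rewrite (bigD1 i)//= !mxE !eqxx mulr1 big1 ?addr0// => k ki.
by rewrite !mxE eqxx (negPf ki) mulr0 mul0r.
Qed.

Lemma norm_delta_le1 (R : realType) (d : nat) (i : 'I_d) :
  `|delta_mx 0 i : 'rV[R]_d| <= 1.
Proof.
apply: rV_norm_le => // j; rewrite !mxE eqxx/=.
by case: eqP; rewrite ?normr1 ?normr0 ?ler01.
Qed.

(** The mean value theorem is applied twice: along [i] to the increment [f (u + a) - f u], then
    along [j] to [partial i f]. Each application moves the point by at most [s]. *)
Lemma mixed_difference (R : realType) (d : nat) (f : 'rV[R]_d -> R)
    (x : 'rV[R]_d) (i j : 'I_d) (s : R) : classC2 f -> 0 <= s ->
  exists2 xi, `|xi - x| <= 2 * s &
    f (x + s *: delta_mx 0 i + s *: delta_mx 0 j) - f (x + s *: delta_mx 0 i)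
      - (f (x + s *: delta_mx 0 j) - f x)
    = s * (s * partial j (partial i f) xi).
Proof.
move=> [[df _] hf] s0; set a : 'rV[R]_d := s *: delta_mx 0 j.
set b : 'rV[R]_d := s *: delta_mx 0 i.
have dshift z : differentiable (fun u => f (u + a)) z.
  apply: (@differentiable_comp _ _ _ _ (fun u => u + a) f); last exact: df.
  exact: (@differentiableD _ _ _ id (cst a)).
have dphi z : differentiable (fun u => f (u + a) - f u) z.
  exact: (@differentiableB _ _ _ (fun u => f (u + a)) f).
have KD (p q : 'rV[R]_d) : p + q - p = q by rewrite addrAC subrr add0r.
have [t /andP[t0 t1]] := partial_mvt dphi (x + b) x.
rewrite KD sum_scale_delta => ->.
set z := x + t *: b.
have -> : partial i (fun u => f (u + a) - f u) z = partial i f (z + a) - partial i f z.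
  rewrite /partial (@deriveB _ _ _ (fun u => f (u + a)) f _ _
    (diff_derivable (dshift z)) (diff_derivable (df z))); congr (_ - _).
  have E : (fun h : R => h^-1 *: (((fun u => f (u + a)) \o shift z)
              (h *: delta_mx 0 i) - f (z + a))) =
           (fun h : R => h^-1 *: ((f \o shift (z + a)) (h *: delta_mx 0 i) - f (z + a))).
    by apply/funext => h /=; congr (_ *: (f _ - _)); exact/esym/addrA.
  by rewrite /derive E.
have [u /andP[u0 u1]] := partial_mvt (hf i).1 (z + a) z.
rewrite KD sum_scale_delta => ->.
exists (z + u *: a) => //.
rewrite /z -[x + _ + _]addrA KD.
have nn k r : 0 <= r <= 1 -> `|r *: (s *: (delta_mx 0 k : 'rV[R]_d))| <= s.
  move=> /andP[r0 r1]; rewrite !normrZ !ger0_norm//.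
  have := norm_delta_le1 R k => n1; have n0 := normr_ge0 (delta_mx 0 k : 'rV[R]_d).
  by rewrite -[leRHS]mul1r ler_pM ?mulr_ge0// -[leRHS]mulr1 ler_pM.
apply: le_trans (ler_normD _ _) _.
have := nn i t; have := nn j u; rewrite t0 t1 u0 u1 => /(_ isT) + /(_ isT).
by rewrite -/a -/b; lra.
Qed.

(** Divided by [s ^+ 2], [D s] tends to both [P x] and [Q x] as [s] tends to 0. *)
Lemma second_difference_unique (R : realType) (d : nat)
    (D : R -> R) (P Q : 'rV[R]_d -> R) (x : 'rV[R]_d) :
  {for x, continuous P} -> {for x, continuous Q} ->
  (forall s, 0 <= s -> exists2 xi, `|xi - x| <= 2 * s & D s = s * (s * P xi)) ->
  (forall s, 0 <= s -> exists2 xi, `|xi - x| <= 2 * s & D s = s * (s * Q xi)) ->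
  P x = Q x.
Proof.
move=> cP cQ DP DQ; apply/eqP; rewrite -subr_eq0 -normr_le0.
apply/ler_addgt0Pr => e e0; rewrite add0r.
have e20 : 0 < e / 2 by rewrite divr_gt0.
have : \forall z \near x, `|P x - P z| < e / 2 /\ `|Q x - Q z| < e / 2.
  have /cvgrPdist_lt/(_ _ e20) h1 := cP.
  have /cvgrPdist_lt/(_ _ e20) h2 := cQ.
  exact: filterI h1 h2.
move=> /nbhs_ballP[r /= r0 hr].
have s0 : 0 < r / 4 by rewrite divr_gt0.
have bx z : `|z - x| <= 2 * (r / 4) -> ball x r z.
  by move=> h; rewrite -ball_normE/= distrC; apply: le_lt_trans h _; lra.
have [xi /bx/hr[hP _] DE] := DP _ (ltW s0).
have [eta /bx/hr[_ hQ]] := DQ _ (ltW s0).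
rewrite DE => /(mulfI (lt0r_neq0 s0))/(mulfI (lt0r_neq0 s0)) E.
rewrite -E in hQ; rewrite -(subrK (P xi) (P x)) -addrA.
apply: le_trans (ler_normD _ _) _.
by rewrite [e]splitr lerD// ltW// distrC.
Qed.

(** Schwarz's theorem: the mixed second difference is symmetric in its two directions. *)
Lemma hessian_sym (R : realType) (d : nat) (f : 'rV[R]_d -> R)
    (x : 'rV[R]_d) (i j : 'I_d) : classC2 f ->
  partial j (partial i f) x = partial i (partial j f) x.
Proof.
move=> hf.
pose D s := f (x + s *: delta_mx 0 i + s *: delta_mx 0 j) - f (x + s *: delta_mx 0 i)
  - (f (x + s *: delta_mx 0 j) - f x).
apply: (@second_difference_unique _ _ D).
- exact: (hf.2 i).2.
- exact: (hf.2 j).2.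
- by move=> s s0; exact: mixed_difference.
- move=> s s0; have [xi xix E] := mixed_difference x j i hf s0; exists xi => //.
  apply: etrans E; rewrite /D [X in f X - _ - _ = _]addrAC.
  have aux (a b c e : R) : a - b - (c - e) = a - c - (b - e) by ring.
  exact: aux.
Qed.

Lemma ler_sum_row (R : realType) (d : nat) (G : 'I_d -> 'I_d -> R) (j : 'I_d) :
  (forall j i, 0 <= G j i) -> \sum_i G j i <= \sum_j \sum_i G j i.
Proof.
move=> G0; rewrite [leRHS](bigD1 j)//= lerDl.
by apply: sumr_ge0 => k _; exact: sumr_ge0.
Qed.

(** The second derivatives are bounded on the ball of radius [K] by compactness, and the segment in
    the mean value theorem stays in this ball by convexity. *)
Lemma partial_lipschitz (R : realType) (d : nat) (f : 'rV[R]_d -> R) (K : R) :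
  classC2 f -> 0 <= K -> exists2 L : R, 0 <= L & forall (x y : 'rV[R]_d) j,
    `|x| <= K -> `|y| <= K -> `|partial j f x - partial j f y| <= L * `|x - y|.
Proof.
move=> hf K0; pose D (z : 'rV[R]_d) := \sum_j \sum_i `|partial i (partial j f) z|.
pose B := [set z : 'rV[R]_d | `|z| <= K].
have Dc : continuous D.
  apply: continuous_big => [|j _]; first exact: add_continuous.
  apply: continuous_big => [|i _]; first exact: add_continuous.
  move=> z; apply: (@continuous_comp _ _ _ (partial i (partial j f)) (fun r => `|r|)).
    exact: ((hf.2 j).2 i z).
  exact: norm_continuous.
have [c _ hc] : exists2 c, c \in B & forall t, t \in B -> D t <= D c.
  apply: EVT_max_rV.
  - by exists 0; rewrite /B /= normr0.
  - apply: bounded_closed_compact.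
      by exists K; split=> [|M KM z /= zK]; rewrite ?num_real// (le_trans zK)// ltW.
    rewrite (_ : B = [set z | (fun z => `|z|) z <= K])//.
    by apply: closed_comp (@closed_le _ K) => z _; exact: norm_continuous.
  - exact: continuous_subspaceT.
have D0 z : 0 <= D z by apply: sumr_ge0 => j _; exact: sumr_ge0.
exists (D c); first exact: D0.
move=> x y j xK yK.
have [t /andP[t0 t1] ->] := partial_mvt (hf.2 j).1 x y.
set z := y + _; have zB : z \in B.
  rewrite inE /B /= /z (_ : _ + _ = (1 - t) *: y + t *: x); last first.
    by apply/rowP => k; rewrite !mxE; ring.
  apply: le_trans (ler_normD _ _) _; rewrite !normrZ !ger0_norm ?subr_ge0//.
  have -> : K = (1 - t) * K + t * K by ring.
  by rewrite lerD// ler_wpM2l// subr_ge0.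
apply: le_trans (ler_norm_sum _ _ _) _.
have Dj : \sum_i `|partial i (partial j f) z| <= D z.
  exact: (@ler_sum_row _ _ (fun j i => `|partial i (partial j f) z|)).
apply: (@le_trans _ _ (\sum_i `|partial i (partial j f) z| * `|x - y|)).
  apply: ler_sum => i _; rewrite normrM mulrC ler_wpM2l//.
  exact: rV_coord_le.
rewrite -mulr_suml; apply: ler_wpM2r; first exact: normr_ge0.
exact: le_trans Dj (hc _ zB).
Qed.

(** Near [x0] the second derivatives differ from those at [x0] by less than [e], which the mean
    value theorem carries over to gradient differences. Both points are free, as the comparison of
    two curves requires. *)
Lemma partial_linearization (R : realType) (d : nat) (f : 'rV[R]_d -> R)
    (x0 : 'rV[R]_d) (e : R) : classC2 f -> 0 < e ->
  exists2 r : R, 0 < r & forall (x y : 'rV[R]_d) j,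
    ball x0 r x -> ball x0 r y ->
    `|partial j f x - partial j f y - ((x - y) *m hessian f x0) 0 j|
      <= d%:R * e * `|x - y|.
Proof.
move=> hf e0.
have : \forall z \near x0, forall (j i : 'I_d),
    `|partial i (partial j f) x0 - partial i (partial j f) z| < e.
  have FF : Filter (nbhs x0) := nbhs_filter x0.
  apply: (@filter_forall _ _ _ _ FF) => j; apply: (@filter_forall _ _ _ _ FF) => i.
  by have /cvgrPdist_lt/(_ _ e0) := (hf.2 j).2 i x0.
move=> /nbhs_ballP[r /= r0 hr]; exists r => // x y j xr yr.
have [t /andP[t0 t1] ->] := partial_mvt (hf.2 j).1 x y.
set z := y + _; have zr : ball x0 r z.
  move: xr yr; rewrite -!ball_normE/= => xr yr.
  rewrite (_ : _ - _ = (1 - t) *: (x0 - y) + t *: (x0 - x)); last first.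
    by apply/rowP => k; rewrite !mxE; ring.
  apply: le_lt_trans (ler_normD _ _) _; rewrite !normrZ !ger0_norm ?subr_ge0//.
  (* For [t > 0] strictness comes from the second summand, which vanishes at [t = 0]. *)
  have [->|tn] := eqVneq t 0; first by rewrite subr0 mul1r mul0r addr0.
  have tp : 0 < t by rewrite lt0r tn.
  have -> : r = (1 - t) * r + t * r by ring.
  by rewrite ler_ltD ?ltr_pM2l// ler_wpM2l ?subr_ge0// ltW.
rewrite !mxE -sumrB; apply: le_trans (ler_norm_sum _ _ _) _.
apply: (@le_trans _ _ (\sum_(i < d) e * `|x - y|)); last first.
  by rewrite sumr_const card_ord -mulrA mulr_natl.
apply: ler_sum => i _; rewrite -mulrBr normrM mulrC ler_pM//.
  by rewrite !mxE distrC ltW// hr.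
exact: rV_coord_le.
Qed.

(** * Bilinear forms *)

Definition bform (R : realType) (d : nat) (M : 'M[R]_d) (x y : 'rV[R]_d) : R :=
  \sum_j (x *m M) 0 j * y 0 j.

(** The square of [enorm]. Unlike the sup norm it can be differentiated along curves; in the
    estimates the two are comparable up to the factor [d]. *)
Definition sqnorm (R : realType) (d : nat) (x : 'rV[R]_d) : R :=
  \sum_j x 0 j ^+ 2.

Lemma bformDl (R : realType) (d : nat) (M : 'M[R]_d) (x x' y : 'rV[R]_d) :
  bform M (x + x') y = bform M x y + bform M x' y.
Proof.
by rewrite /bform mulmxDl -big_split; apply: eq_bigr => j _; rewrite mxE mulrDl.
Qed.

Lemma bformDr (R : realType) (d : nat) (M : 'M[R]_d) (x y y' : 'rV[R]_d) :
  bform M x (y + y') = bform M x y + bform M x y'.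
Proof. by rewrite /bform -big_split; apply: eq_bigr => j _; rewrite [(y + y') _ _]mxE mulrDr. Qed.

Lemma bformZl (R : realType) (d : nat) (M : 'M[R]_d) (a : R) (x y : 'rV[R]_d) :
  bform M (a *: x) y = a * bform M x y.
Proof.
by rewrite /bform -scalemxAl mulr_sumr; apply: eq_bigr => j _; rewrite mxE mulrA.
Qed.

Lemma bformZr (R : realType) (d : nat) (M : 'M[R]_d) (a : R) (x y : 'rV[R]_d) :
  bform M x (a *: y) = a * bform M x y.
Proof.
by rewrite /bform mulr_sumr; apply: eq_bigr => j _; rewrite [(a *: y) _ _]mxE mulrCA.
Qed.

Lemma bform_sym (R : realType) (d : nat) (M : 'M[R]_d) (x y : 'rV[R]_d) :
  M^T = M -> bform M x y = bform M y x.
Proof.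
move=> MT.
have E (u w : 'rV[R]_d) : bform M u w = \sum_j \sum_i u 0 i * M i j * w 0 j.
  by apply: eq_bigr => j _; rewrite mxE mulr_suml.
rewrite !E exchange_big; apply: eq_bigr => j _; apply: eq_bigr => i _.
have -> : M j i = M i j by rewrite -[in LHS]MT mxE.
by ring.
Qed.

Lemma bform_shift (R : realType) (d : nat) (H : 'M[R]_d) (c : R) (x y : 'rV[R]_d) :
  bform (H + c%:M) x y = bform H x y + c * \sum_j x 0 j * y 0 j.
Proof.
rewrite /bform mulmxDr mul_mx_scalar mulr_sumr -big_split.
by apply: eq_bigr => j _; rewrite [(x *m H + c *: x) _ _]mxE [(c *: x) _ _]mxE /=; ring.
Qed.

Lemma natr_mul_sum (R : realType) (d : nat) (a : R) : d%:R * a = \sum_(i < d) a.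
Proof. by rewrite sumr_const card_ord mulr_natl. Qed.

Lemma sqnorm_ge0 (R : realType) (d : nat) (x : 'rV[R]_d) : 0 <= sqnorm x.
Proof. by apply: sumr_ge0 => j _; exact: sqr_ge0. Qed.

Lemma sqr_norm_le_sqnorm (R : realType) (d : nat) (x : 'rV[R]_d) :
  `|x| ^+ 2 <= sqnorm x.
Proof.
rewrite -ler_sqrt ?sqnorm_ge0// sqrtr_sqr ger0_norm//.
apply: rV_norm_le => [|i]; first exact: sqrtr_ge0.
rewrite -sqrtr_sqr ler_sqrt ?sqnorm_ge0// /sqnorm (bigD1 i)//= lerDl.
by apply: sumr_ge0 => j _; exact: sqr_ge0.
Qed.

Lemma sqnorm_gt0 (R : realType) (d : nat) (x : 'rV[R]_d) :
  x != 0 -> 0 < sqnorm x.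
Proof.
move=> x0; apply: lt_le_trans (sqr_norm_le_sqnorm x).
by rewrite exprn_gt0// normr_gt0.
Qed.

Lemma sqnorm_le (R : realType) (d : nat) (x : 'rV[R]_d) :
  sqnorm x <= d%:R * `|x| ^+ 2.
Proof.
rewrite natr_mul_sum; apply: ler_sum => i _.
by rewrite -real_normK ?num_real// lerXn2r ?nnegrE// rV_coord_le.
Qed.

Lemma dot_le (R : realType) (d : nat) (x y : 'rV[R]_d) :
  `|\sum_j x 0 j * y 0 j| <= d%:R * (`|x| * `|y|).
Proof.
apply: le_trans (ler_norm_sum _ _ _) _.
rewrite natr_mul_sum; apply: ler_sum => i _.
by rewrite normrM ler_pM// rV_coord_le.
Qed.

Lemma mulmx_bounded (R : realType) (d : nat) (M : 'M[R]_d) :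
  exists2 B : R, 0 <= B & forall x : 'rV[R]_d, `|x *m M| <= B * `|x|.
Proof.
exists (\sum_j \sum_i `|M i j|).
  by apply: sumr_ge0 => j _; exact: sumr_ge0.
move=> x; apply: rV_norm_le => [|j].
  by rewrite mulr_ge0//; apply: sumr_ge0 => j _; exact: sumr_ge0.
rewrite mxE; apply: le_trans (ler_norm_sum _ _ _) _.
apply: (@le_trans _ _ (\sum_i `|M i j| * `|x|)).
  by apply: ler_sum => i _; rewrite normrM mulrC ler_wpM2l// rV_coord_le.
rewrite -mulr_suml ler_wpM2r//.
exact: (@ler_sum_row _ _ (fun j i => `|M i j|)).
Qed.

Lemma bform_bounded (R : realType) (d : nat) (M : 'M[R]_d) :
  exists2 B : R, 0 <= B & forall x y : 'rV[R]_d, `|bform M x y| <= B * (`|x| * `|y|).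
Proof.
have [B B0 hB] := mulmx_bounded M; exists (d%:R * B); first exact: mulr_ge0.
move=> x y; apply: le_trans (dot_le _ _) _.
by rewrite -mulrA ler_wpM2l// mulrA ler_wpM2r.
Qed.

(** If all the [d.+1] values [c = a / k.+2], which lie strictly below [a], made the shift singular,
    their opposites would be too many roots of the characteristic polynomial. *)
Lemma exists_unit_shift (R : realType) (d : nat) (H : 'M[R]_d) (a : R) :
  0 < a -> exists2 c, 0 < c < a & H + c%:M \in unitmx.
Proof.
move=> a0; apply: contrapT => /forallPNP nc.
pose rs := [seq - (a / k.+2%:R) | k <- iota 0 d.+1].
have Urs : uniq rs.
  rewrite map_inj_uniq ?iota_uniq// => k l /eqP.
  rewrite eqr_opp => /eqP /(mulfI (lt0r_neq0 a0)) /invr_inj /eqP.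
  by rewrite eqr_nat => /eqP[].
have Rrs : all (root (char_poly H)) rs.
  apply/allP => _ /mapP[k _ ->]; rewrite -eigenvalue_root_char.
  have /negP : ~ (H + (a / k.+2%:R)%:M \in unitmx).
    apply: nc; rewrite divr_gt0//= ltr_pdivrMr// ltr_pMr// ltr1n//.
  rewrite unitmxE unitfE negbK => /det0P[v v0 vH].
  apply/eigenvalueP; exists v => //.
  move/eqP: vH; rewrite mulmxDr mul_mx_scalar addr_eq0 => /eqP ->.
  by rewrite scaleNr.
have := max_poly_roots (monic_neq0 (char_poly_monic H)) Rrs Urs.
by rewrite size_char_poly size_map size_iota ltnn.
Qed.

(** * Pairs of gradient descent curves *)

(** The derivative is two-sided even at time 0, so the values of a curve just before 0 matter as
    well. *)
Definition gd_curve (R : realType) (d : nat) (f : 'rV[R]_d -> R)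
    (y : R -> 'rV[R]_d) : Prop :=
  forall t : R, 0 <= t -> forall i, is_derive t 1 (fun s => y s 0 i) (- partial i f (y t)).

Lemma is_derive_bform (R : realType) (d : nat) (M : 'M[R]_d)
    (z : R -> 'rV[R]_d) (dz : 'rV[R]_d) (t : R) : M^T = M ->
  (forall i, is_derive t 1 (fun s => z s 0 i) (dz 0 i)) ->
  is_derive t 1 (fun s => bform M (z s) (z s)) (2 * bform M (z t) dz).
Proof.
move=> MT hz.
have hM j : is_derive t 1 (fun s => (z s *m M) 0 j) ((dz *m M) 0 j).
  have -> : (fun s => (z s *m M) 0 j) = \sum_i (M i j \*: (fun s => z s 0 i)).
    by apply/funext => s; rewrite mxE fct_sumE; apply: eq_bigr => i _; rewrite mulrC.
  have hi i : is_derive t 1 (M i j \*: (fun s => z s 0 i)) (M i j *: dz 0 i : R).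
    exact: is_deriveZ.
  apply: is_derive_eq (is_derive_sum hi) _.
  by rewrite mxE; apply: eq_bigr => i _; rewrite mulrC.
have -> : (fun s => bform M (z s) (z s)) =
    \sum_j ((fun s => (z s *m M) 0 j) * (fun s => z s 0 j)).
  by apply/funext => s; rewrite fct_sumE.
apply: is_derive_eq (is_derive_sum (fun j => is_deriveM (hM j) (hz j))) _.
have -> : 2 * bform M (z t) dz = bform M (z t) dz + bform M dz (z t).
  by rewrite (bform_sym dz)//; ring.
by rewrite /bform -big_split; apply: eq_bigr => j _; rewrite /GRing.scale/=; ring.
Qed.

Lemma bform1 (R : realType) (d : nat) (x y : 'rV[R]_d) :
  bform 1%:M x y = \sum_j x 0 j * y 0 j.
Proof. by rewrite /bform mulmx1. Qed.

Lemma sqnorm_bform (R : realType) (d : nat) (x : 'rV[R]_d) :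
  sqnorm x = bform 1%:M x x.
Proof. by rewrite bform1; apply: eq_bigr => j _; rewrite expr2. Qed.

Section TwoCurves.
Context (R : realType) (d : nat) (f : 'rV[R]_d -> R) (hf : classC2 f).

Lemma gd_curve_sub_derive (x y : R -> 'rV[R]_d) (t : R) :
  gd_curve f x -> gd_curve f y -> 0 <= t ->
  forall i, is_derive t 1 (fun s => (x s - y s) 0 i)
    ((- (gradient f (x t) - gradient f (y t))) 0 i).
Proof.
move=> hx hy t0 i.
have -> : (fun s => (x s - y s) 0 i) = (fun s => x s 0 i) - (fun s => y s 0 i).
  by apply/funext => s; rewrite !mxE.
apply: is_derive_eq (@is_deriveB _ _ _ _ _ _ _ _ _ (hx t t0 i) (hy t t0 i)) _.
by rewrite !mxE opprB opprK addrC.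
Qed.

Lemma gradient_lipschitz (K : R) : 0 <= K ->
  exists2 L : R, 0 <= L & forall x y : 'rV[R]_d, `|x| <= K -> `|y| <= K ->
    `|gradient f x - gradient f y| <= L * `|x - y|.
Proof.
move=> K0; have [L L0 hL] := partial_lipschitz hf K0; exists L => // x y xK yK.
apply: rV_norm_le => [|i]; first exact: mulr_ge0.
by rewrite !mxE; exact: hL.
Qed.

(** The squared distance of two curves changes at a relative rate of at most [2 * d%:R * L], where
    [L] is a Lipschitz constant of the gradient on the ball of radius [K]. It depends on [K] but not
    on the curves. *)
Lemma gd_curve_backward (K : R) : 0 <= K ->
  exists2 L : R, 0 <= L & forall (x y : R -> 'rV[R]_d) (n : R),
    gd_curve f x -> gd_curve f y ->
    (forall t, 0 <= t -> `|x t| <= K) -> (forall t, 0 <= t -> `|y t| <= K) ->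
    0 <= n -> sqnorm (x 0 - y 0) <= expR (L * n) * sqnorm (x n - y n).
Proof.
move=> K0; have [L L0 hL] := gradient_lipschitz K0.
exists (2 * d%:R * L) => [|x y n hx hy xK yK n0]; first by rewrite !mulr_ge0.
set L' := 2 * d%:R * L.
pose z t := x t - y t; pose dz t := - (gradient f (x t) - gradient f (y t)).
have hu (t : R) : 0 <= t <= n ->
    is_derive t 1 (fun s => bform 1%:M (z s) (z s)) (2 * bform 1%:M (z t) (dz t)).
  move=> /andP[t0 _]; apply: is_derive_bform; first exact: trmx1.
  exact: gd_curve_sub_derive.
have hk (t : R) : 0 <= t <= n -> is_derive t 1 (fun s => L' * s) L'.
  move=> _; have := is_deriveZ L' (is_derive_id t (1 : R)).
  by rewrite /GRing.scale/= mulr1.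
have := gronwall_ge n0 hu hk; rewrite mulr0 subr0 -!sqnorm_bform.
apply=> t /andP[t0 _].
have h : `|bform 1%:M (z t) (dz t)| <= d%:R * L * sqnorm (z t).
  rewrite bform1; apply: le_trans (dot_le _ _) _.
  rewrite -mulrA ler_wpM2l// /dz normrN.
  apply: (@le_trans _ _ (`|z t| * (L * `|z t|))).
    by rewrite ler_wpM2l// hL// ?xK ?yK.
  by rewrite mulrCA ler_wpM2l// -expr2 sqr_norm_le_sqnorm.
move: h; rewrite sqnorm_bform ler_norml => /andP[h _].
by rewrite /L'; lra.
Qed.

(* The function g(t) = (x - y) (H + c) (x - y)^T satisfies g' <= 2 c g as long
   as x and y stay close to x0, so that a negative value would make the bounded
   function g blow up. *)
Lemma gd_curve_cone (x0 v : 'rV[R]_d) : bform (hessian f x0) v v < 0 ->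
  exists (M : 'M[R]_d) (r : R),
    [/\ M^T = M, bform M v v < 0, 0 < r &
        forall (x y : R -> 'rV[R]_d) (n : R), 0 <= n ->
          gd_curve f x -> gd_curve f y ->
          (forall t, n <= t -> ball x0 r (x t)) ->
          (forall t, n <= t -> ball x0 r (y t)) ->
          0 <= bform M (x n - y n) (x n - y n)].
Proof.
set H := hessian f x0 => Hv.
have HT : H^T = H by apply/matrixP => i j; rewrite !mxE; exact: hessian_sym.
have sv0 : 0 < sqnorm v.
  apply: sqnorm_gt0; apply: contraTneq Hv => ->.
  by rewrite -(scale0r (0 : 'rV[R]_d)) bformZr mul0r ltxx.
(* The upper bound on [c] is what keeps the shifted form negative at [v]. *)
have [c /andP[c0 cv] Mu] : exists2 c, 0 < c < - bform H v v / sqnorm v &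
    H + c%:M \in unitmx.
  by apply: exists_unit_shift; rewrite divr_gt0// oppr_gt0.
set M := H + c%:M in Mu.
have MT : M^T = M by rewrite /M linearD /= HT tr_scalar_mx.
have [B B0 hB] := mulmx_bounded (invmx M).
have zB (z : 'rV[R]_d) : `|z| <= B * `|z *m M|.
  by rewrite -{1}(mulmxK Mu z).
(* As [|z|] is at most [B * |z *m M|], this [e] makes the linearization error, paired with [z *m M],
   at most [sqnorm (z *m M)]. *)
pose e := (d%:R * d%:R * B + 1)^-1.
have D0 : 0 < d%:R * d%:R * B + 1 by rewrite ltr_wpDl// !mulr_ge0.
have e0 : 0 < e by rewrite invr_gt0.
have [r r0 hr] := partial_linearization x0 hf e0.
have Mv : bform M v v < 0.
  rewrite bform_shift -bform1 -sqnorm_bform.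
  by move: cv; rewrite ltr_pdivlMr//; lra.
exists M, r; split=> // x y n n0 hx hy xr yr; rewrite leNgt; apply/negP => gneg.
pose z t := x t - y t; pose dz t := - (gradient f (x t) - gradient f (y t)).
pose g t := bform M (z t) (z t).
have zr (t : R) : n <= t -> `|z t| <= 2 * r.
  move=> nt; have := xr t nt; have := yr t nt; rewrite -!ball_normE/= => h1 h2.
  have -> : z t = - (x0 - x t) + (x0 - y t).
    by apply/rowP => i; rewrite !mxE; ring.
  by apply: le_trans (ler_normD _ _) _; rewrite normrN; lra.
have dg (t : R) : n <= t -> 2 * bform M (z t) (dz t) <= 2 * c * g t.
  move=> nt; set w := z t *m M.
  pose E := gradient f (x t) - gradient f (y t) - z t *m H.
  have Ez : `|E| <= d%:R * e * `|z t|.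
    apply: rV_norm_le => [|j]; first by rewrite !mulr_ge0// ltW.
    by have := hr (x t) (y t) j (xr t nt) (yr t nt); rewrite !mxE.
  (* Paired with [z t] through [M], the first term gives [- sqnorm w], which absorbs the error [E],
     and the second gives [c * g t]. *)
  have -> : dz t = (- 1) *: w + c *: z t + (- 1) *: E.
    rewrite /dz /w /M mulmxDr mul_mx_scalar /E !scaleN1r.
    by apply/rowP => i; rewrite !mxE; ring.
  rewrite !bformDr !bformZr -/(g t).
  have -> : bform M (z t) w = sqnorm w.
    by rewrite /bform -/w; apply: eq_bigr => j _; rewrite expr2.
  have : `|bform M (z t) E| <= sqnorm w.
    apply: le_trans (dot_le _ _) _; rewrite -/w.
    apply: le_trans (_ : `|w| ^+ 2 <= _); last exact: sqr_norm_le_sqnorm.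
    apply: (@le_trans _ _ (d%:R * (`|w| * (d%:R * e * (B * `|w|))))).
      rewrite ler_wpM2l// ler_wpM2l// (le_trans Ez)// ler_wpM2l//.
      by rewrite mulr_ge0// ltW.
    have -> : d%:R * (`|w| * (d%:R * e * (B * `|w|))) =
      (e * (d%:R * d%:R * B)) * `|w| ^+ 2 by ring.
    rewrite ler_piMl ?exprn_ge0// /e mulrC ler_pdivrMr// mul1r lerDl//.
  rewrite ler_norml => /andP[h1 _]; lra.
have hg (t : R) : n <= t -> is_derive t 1 g (2 * bform M (z t) (dz t)).
  move=> nt; apply: is_derive_bform => //; apply: gd_curve_sub_derive => //.
  exact: le_trans nt.
have hk (t : R) : is_derive t 1 (fun s => 2 * c * s) (2 * c).
  have := is_deriveZ (2 * c) (is_derive_id t (1 : R)).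
  by rewrite /GRing.scale/= mulr1.
have growth (t : R) : n <= t -> g t <= expR (2 * c * t - 2 * c * n) * g n.
  move=> nt; apply: (gronwall nt (du := fun s => 2 * bform M (z s) (dz s))
    (dk := fun=> 2 * c) (k := fun s => 2 * c * s)) => s /andP[ns _] //.
  - exact: hg.
  - exact: dg.
have [Q Q0 hQ] := bform_bounded M.
pose q := Q * (2 * r * (2 * r)).
have gq (t : R) : n <= t -> - q <= g t.
  move=> nt; have := hQ (z t) (z t); rewrite ler_norml => /andP[+ _].
  apply: le_trans; rewrite lerN2; apply: ler_wpM2l => //.
  by apply: ler_pM; rewrite ?normr_ge0 ?zr.
have q0 : 0 <= q by rewrite mulr_ge0// mulr_ge0// mulr_ge0// ltW.
(* At this time the growth factor is [expR (q / - g n)], which exceeds [q / - g n]; hence [g t]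
   would fall below [- q]. *)
pose t := n + q / (- g n) / (2 * c).
have gn0 : g n < 0 by exact: gneg.
have nt : n <= t.
  by rewrite lerDl divr_ge0 ?divr_ge0 ?mulr_ge0// ?oppr_ge0 ltW.
have := le_trans (gq t nt) (growth t nt); apply/negP; rewrite -ltNge.
have -> : 2 * c * t - 2 * c * n = q / (- g n).
  by rewrite /t; field; rewrite (gt_eqF c0) (lt_eqF gn0).
rewrite -ltrN2 opprK -mulrN -ltr_pdivrMr ?oppr_gt0//.
apply: lt_le_trans (expR_ge1Dx _); lra.
Qed.

End TwoCurves.

(** * Null sets of trapped initial points *)

(* Projection along v onto the hyperplane x_i = 0, whose coordinate i is then
   dropped; it is meaningful for v_i <> 0 only. *)
Definition proj_along (R : realType) (m : nat) (v : 'rV[R]_m.+1)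
    (i : 'I_m.+1) (z : 'rV[R]_m.+1) : 'rV[R]_m :=
  \row_j (z 0 (lift i j) - z 0 i / v 0 i * v 0 (lift i j)).

Lemma proj_alongB (R : realType) (m : nat) (v : 'rV[R]_m.+1) (i : 'I_m.+1)
    (x y : 'rV[R]_m.+1) :
  proj_along v i (x - y) = proj_along v i x - proj_along v i y.
Proof. by apply/rowP => j; rewrite !mxE; ring. Qed.

Lemma proj_along_bounded (R : realType) (m : nat) (v : 'rV[R]_m.+1)
    (i : 'I_m.+1) (z : 'rV[R]_m.+1) :
  `|proj_along v i z| <= (1 + `|v| / `|v 0 i|) * `|z|.
Proof.
have q0 : 0 <= `|v| / `|v 0 i| by rewrite divr_ge0.
apply: rV_norm_le => [|j]; first by rewrite mulr_ge0// addr_ge0.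
rewrite mxE mulrDl mul1r; apply: le_trans (ler_normB _ _) _.
rewrite lerD ?rV_coord_le// !normrM normfV.
rewrite -mulrA [leRHS]mulrC; apply: ler_pM.
- exact: normr_ge0.
- by rewrite mulr_ge0// invr_ge0.
- exact: rV_coord_le.
- by rewrite mulrC; apply: ler_wpM2r; rewrite ?invr_ge0// rV_coord_le.
Qed.

(** Write [z = s *: v + p] with [p] vanishing in coordinate [i]. Nonnegativity of the form at [z]
    prevents [s] from dominating, since the term [- a * s ^+ 2] would then prevail; so [p], which
    the projection controls, controls [z]. *)
Lemma cone_proj_along (R : realType) (m : nat) (M : 'M[R]_m.+1)
    (v : 'rV[R]_m.+1) (i : 'I_m.+1) :
  M^T = M -> bform M v v < 0 -> v 0 i != 0 ->
  exists2 C : R, 0 <= C & forall z, 0 <= bform M z z ->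
    `|z| <= C * `|proj_along v i z|.
Proof.
move=> MT Mv vi0; have [B B0 hB] := bform_bounded M.
pose a := - bform M v v; have a0 : 0 < a by rewrite oppr_gt0.
pose b := 2 * B * `|v| + B; have b0 : 0 <= b by rewrite addr_ge0// !mulr_ge0.
(* The summand 1 ensures [|p| <= |s|] whenever [|s| > C * |p|], so that the term quadratic in [p] is
   bounded by [B * (|s| * |p|)]. *)
pose C := 1 + 2 * b / a.
have C1 : 1 <= C by rewrite lerDl divr_ge0 ?mulr_ge0// ltW.
exists (1 + C * `|v|) => [|z Mz]; first by rewrite addr_ge0// mulr_ge0// (le_trans ler01).
set w := proj_along v i z.
have [s [p zE pw]] : exists s, exists2 p, z = s *: v + p & `|p| <= `|w|.
  exists (z 0 i / v 0 i), (z - (z 0 i / v 0 i) *: v); first by rewrite addrC subrK.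
  apply: rV_norm_le => // k; rewrite !mxE; case: (unliftP i k) => [j ->|->].
    by have := rV_coord_le w j; rewrite mxE.
  by rewrite divfK// subrr normr0.
have gE : bform M z z = - a * s ^+ 2 + 2 * s * bform M v p + bform M p p.
  rewrite {1 2}zE !bformDl !bformDr !bformZl !bformZr (bform_sym p v MT) /a; ring.
have sC : `|s| <= C * `|p|.
  rewrite leNgt; apply/negP => sp.
  have s0 : 0 < `|s| by apply: le_lt_trans sp; rewrite mulr_ge0// (le_trans ler01).
  have ps : `|p| <= `|s|.
    by rewrite ltW//; apply: le_lt_trans sp; rewrite ler_peMl.
  have h1 : 2 * s * bform M v p <= 2 * B * `|v| * (`|s| * `|p|).
    apply: le_trans (ler_norm _) _; rewrite !normrM ger0_norm//.
    have := hB v p => h; have -> : 2 * B * `|v| * (`|s| * `|p|) =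
      2 * `|s| * (B * (`|v| * `|p|)) by ring.
    by rewrite ler_wpM2l// mulr_ge0.
  have h2 : bform M p p <= B * (`|s| * `|p|).
    apply: le_trans (ler_norm _) _; apply: le_trans (hB _ _) _.
    by rewrite ler_wpM2l// ler_wpM2r.
  have h3 : a * `|s| ^+ 2 <= b * (`|s| * `|p|).
    rewrite real_normK ?num_real// /b; move: Mz; rewrite gE; lra.
  move: h3; rewrite expr2 !mulrA [b * _]mulrC -mulrA [a * _]mulrC -!mulrA.
  rewrite ler_pM2l// => h3.
  have : a * (C * `|p|) < a * `|s| by rewrite ltr_pM2l.
  have -> : a * (C * `|p|) = a * `|p| + 2 * b * `|p|.
    by rewrite /C; field; rewrite gt_eqF.
  have : 0 <= b * `|p| by rewrite mulr_ge0.
  have : 0 <= a * `|p| by rewrite mulr_ge0// ltW.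
  lra.
rewrite [X in `|X|]zE; apply: le_trans (ler_normD _ _) _.
rewrite normrZ addrC mulrDl mul1r lerD// -mulrA [`|v| * _]mulrC mulrA ler_wpM2r//.
by apply: le_trans sC _; rewrite ler_wpM2l// (le_trans ler01).
Qed.

(** The bound [K] provides a Lipschitz constant for the gradient along the curve; entrance times are
    natural numbers so that a countable union exhausts the set. *)
Definition trapped (R : realType) (d : nat) (f : 'rV[R]_d -> R)
    (c : 'rV[R]_d) (r : R) : set 'rV[R]_d :=
  [set a | exists y, [/\ gd_curve f y, y 0 = a,
    exists K : R, forall t, 0 <= t -> `|y t| <= K &
    exists n : nat, forall t, n%:R <= t -> ball c r (y t)]].

Lemma trapped_null (R : realType) (d : nat) (f : 'rV[R]_d -> R)
    (x0 v : 'rV[R]_d) : classC2 f -> bform (hessian f x0) v v < 0 ->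
  exists2 r : R, 0 < r & lebesgue_null (trapped f x0 r).
Proof.
(* In dimension 0 the form is zero, hence not negative at [v]. *)
case: d f x0 v => [|m] f x0 v hf Hv.
  by move: Hv; rewrite /bform big_ord0 ltxx.
have [M [r [MT Mv r0 cone]]] := gd_curve_cone hf Hv.
have [i vi0] : exists i, v 0 i != 0.
  apply/existsP; apply: contraTT Mv => /existsPn v0; rewrite -leNgt.
  by rewrite /bform big1// => j _; have := v0 j; rewrite negbK => /eqP ->; rewrite mulr0.
have [C C0 hC] := cone_proj_along MT Mv vi0.
exists r => //.
pose A (n k : nat) := [set a | exists y, [/\ gd_curve f y, y 0 = a,
  forall t : R, 0 <= t -> `|y t| <= k%:R &
  forall t : R, n%:R <= t -> ball x0 r (y t)]].
suff Anull n k : lebesgue_null (A n k).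
  apply: lebesgue_null_sub (lebesgue_null_bigcup
    (fun n => lebesgue_null_bigcup (Anull n))) => a [y [hy ya [K yK] [n yn]]].
  exists n => //; exists (Num.truncn K).+1 => //; exists y; split=> // t t0.
  by apply: le_trans (yK t t0) _; rewrite ltW// truncnS_gt.
have [L L0 back] := gd_curve_backward hf (ler0n R k).
(* One curve is selected for each initial point, the zero curve standing for points outside
   [A n k]. *)
have /choice[Y hY] : forall a, exists y : R -> 'rV[R]_m.+1, A n k a ->
    [/\ gd_curve f y, y 0 = a, forall t : R, 0 <= t -> `|y t| <= k%:R &
        forall t : R, n%:R <= t -> ball x0 r (y t)].
  move=> a; have [[y hy]|nA] := pselect (A n k a); first by exists y.
  by exists (fun=> 0) => /nA.
(* The exponential comes from the backward estimate, the factor [m.+1] from comparing the Euclidean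
   norm with the sup norm. *)
pose q := expR (L * n%:R) * m.+1%:R.
have q0 : 0 <= q by rewrite mulr_ge0// expR_ge0.
apply: (@lebesgue_null_chart _ _ _ (fun a => proj_along v i (Y a n%:R))
  ((1 + `|v| / `|v 0 i|) * k%:R) (Num.sqrt q * C)).
  move=> a /hY[_ _ yk _]; apply: le_trans (proj_along_bounded _ _ _) _.
  by rewrite ler_wpM2l ?yk// addr_ge0// divr_ge0.
move=> a b /hY[ga Ya ka ba] /hY[gb Yb kb bb].
have := cone _ _ n%:R (ler0n _ _) ga gb ba bb.
move=> /hC; rewrite proj_alongB => /(ler_wpM2l (sqrtr_ge0 q)); rewrite mulrA.
apply: le_trans.
rewrite -[in leLHS]Ya -[in leLHS]Yb -[leLHS]ger0_norm// -sqrtr_sqr -[X in _ * X]ger0_norm// -sqrtr_sqr.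
rewrite -sqrtrM// ler_sqrt ?mulr_ge0 ?sqr_ge0//.
apply: le_trans (sqr_norm_le_sqnorm _) _.
apply: le_trans (back _ _ n%:R ga gb ka kb (ler0n _ _)) _.
rewrite /q -mulrA ler_wpM2l ?expR_ge0//; exact: sqnorm_le.
Qed.

(** * From normalized to ordinary gradient descent *)

Lemma lifespan_room (R : realType) (T : \bar R) (t : R) :
  (t%:E < T)%E -> exists2 u, t < u & (u%:E < T)%E.
Proof.
case: T => [r|_|//]; last by exists (t + 1); rewrite ?ltrDl ?ltry.
rewrite lte_fin => tr; exists ((t + r) / 2); rewrite ?lte_fin; lra.
Qed.

(** Gives finite and infinite end times a common form, with a threshold that itself lies in the
    lifespan. *)
Lemma cvg_to_end (R : realType) (d : nat) (T : \bar R) (x : R -> 'rV[R]_d)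
    (l : 'rV[R]_d) (e : R) : (0 < T)%E -> x @ to_end T --> l -> 0 < e ->
  exists2 t1, lifespan T t1 & forall t, lifespan T t -> t1 <= t -> `|l - x t| < e.
Proof.
case: T => [r||//] /= T0 xl e0.
- have [r' /= r'0 h] : \forall t \near r^'-, `|l - x t| < e.
    by move: xl => /cvgrPdist_lt/(_ _ e0).
  exists (Num.max 0 (r - r' / 2)).
    by split; rewrite ?le_max ?lexx// lte_fin gt_max; apply/andP; split=> //; lra.
  move=> t [t0]; rewrite lte_fin => tr; rewrite ge_max => /andP[_ t1].
  by apply: h => //=; rewrite gtr0_norm ?subr_gt0//; lra.
- have [M [_ h]] : \forall t \near +oo%R, `|l - x t| < e.
    by move: xl => /cvgrPdist_lt/(_ _ e0).
  exists (Num.max 0 (M + 1)).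
    by split; rewrite ?le_max ?lexx// ltry.
  by move=> t _; rewrite ge_max => /andP[_ t1]; apply: h; lra.
Qed.

Lemma within_derivative_near (R : realType) (d : nat) (I : set R)
    (x : R -> 'rV[R]_d) (t : R) (v : 'rV[R]_d) (e : R) :
  has_derivative_within I x t v -> 0 < e ->
  \forall s \near t, I s -> s != t -> `|v - (s - t)^-1 *: (x s - x t)| < e.
Proof.
move=> hd e0.
have H : nbhs t [set s | s != t -> I s -> `|v - (s - t)^-1 *: (x s - x t)| < e].
  by move/cvgrPdist_lt: hd => /(_ _ e0).
by apply: filterS H => s hs Is st; exact: hs.
Qed.

(* Extending a solution linearly to negative times makes it differentiable on
   both sides at time 0. *)
Definition extend_left (R : realType) (d : nat) (x : R -> 'rV[R]_d)
    (v : 'rV[R]_d) (t : R) : 'rV[R]_d :=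
  if t < 0 then x 0 + t *: v else x t.

Lemma extend_left_derive (R : realType) (d : nat) (T : \bar R)
    (x dx : R -> 'rV[R]_d) (t : R) : lifespan T t ->
  has_derivative_within (lifespan T) x t (dx t) ->
  is_derive t 1 (extend_left x (dx 0)) (dx t).
Proof.
move=> [t0 tT] hd; set X := extend_left x (dx 0).
have [u tu uT] := lifespan_room tT.
have Xt : X t = x t by rewrite /X /extend_left ltNge t0.
suff lim : (fun h : R => h^-1 *: ((X \o shift t) (h *: 1) - X t)) @ 0^' --> dx t.
  by apply: DeriveDef; [apply/cvg_ex; exists (dx t)|exact: cvg_lim].
apply/cvgrPdist_lt => e e0.
have near1 := within_derivative_near hd e0.
have : \forall s \near t, s != t -> `|dx t - (s - t)^-1 *: (X s - X t)| < e.
  have near2 : \forall s \near t, s < u by exact: lt_nbhsl.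
  have near3 : \forall s \near t, 0 < t -> 0 < s.
    have [tp|tn] := ltP 0 t; last first.
      by near=> s.
    by have := lt_nbhsr tp; apply: filterS => s.
  near=> s => st.
  (* Negative [s] only occur for [t = 0], where the quotient of the linear extension is exactly
     [dx 0]. *)
  have [s0|s0] := ltP s 0.
    have t00 : t = 0.
      apply/eqP; rewrite eq_le t0 andbT leNgt; apply/negP => tp.
      have : 0 < t -> 0 < s by near: s.
      by move=> /(_ tp); rewrite ltNge ltW.
    rewrite Xt t00 {1}/X /extend_left s0 subr0 addrAC subrr add0r scalerA mulVf.
      by rewrite scale1r subrr normr0.
    by rewrite lt_eqF.
  have -> : X s = x s by rewrite /X /extend_left ltNge s0.
  rewrite Xt.
  have : lifespan T s -> s != t -> `|dx t - (s - t)^-1 *: (x s - x t)| < e by near: s.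
  apply=> //; split=> //; apply: lt_trans uT; rewrite lte_fin; by near: s.
move=> /nbhs_ballP[r /= r0 hr]; exists r => // h; rewrite /ball_ /= sub0r normrN => hr0 h0.
have := hr (h + t); rewrite -ball_normE/= opprD addrCA subrr addr0 normrN.
rewrite addrK [_%:A]mulr1; apply=> //.
by rewrite -subr_eq0 addrK.
Unshelve. all: by end_near. Qed.

Lemma is_derive_coord (R : realType) (d : nat) (x : R -> 'rV[R]_d) (t : R)
    (v : 'rV[R]_d) (i : 'I_d) : is_derive t 1 x v ->
  is_derive t 1 (fun s => x s 0 i) (v 0 i).
Proof.
move=> [dx dv]; have /derivable_mxP/(_ 0 i) dxi := dx.
by apply: DeriveDef => //; rewrite -dv derive_mx// mxE.
Qed.

Lemma primitive (R : realType) (h : R -> R) (T : \bar R) :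
  (forall t, (t%:E < T)%E -> {for t, continuous h}) ->
  exists2 s : R -> R, s 0 = 0 &
    forall t, -1 < t -> (t%:E < T)%E -> is_derive t 1 s (h t).
Proof.
move=> hc; pose mu := @lebesgue_measure R.
(* Integrating from -1 makes 0 an interior point, so that the derivative there is two-sided. *)
pose F y := (\int[mu]_(t in [set` `[-1, y]]) (h t))%R.
exists (fun y => F y - F 0); first by rewrite subrr.
move=> t t1 tT; have [u tu uT] := lifespan_room tT.
have hint : mu.-integrable `[-1, u] (EFin \o h).
  apply: continuous_compact_integrable; first exact: segment_compact.
  apply: continuous_in_subspaceT => s; rewrite inE/= in_itv/= => /andP[_ su].
  by apply: hc; apply: le_lt_trans uT; rewrite lee_fin.
have [dF Fh] := continuous_FTC1_closed tu hint t1 (hc t tT).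
rewrite derive1E in Fh.
have hF : is_derive t 1 F (h t) := DeriveDef dF Fh.
apply: is_derive_eq (is_deriveB hF (is_derive_cst (F 0) t 1)) _.
by rewrite subr0.
Qed.

(** Here [s] is the new time as a function of the old one and [h] its positive rate. Times down to
    -1 are included to have a neighbourhood of 0. *)
Section Clock.
Context (R : realType) (T : \bar R) (s h : R -> R).
Context (sh : forall t : R, -1 < t -> (t%:E < T)%E -> is_derive t 1 s (h t)).
Context (h0 : forall t : R, -1 < t -> (t%:E < T)%E -> 0 < h t).

Lemma clock_incr (t u : R) : -1 < t -> t < u -> (u%:E < T)%E -> s t < s u.
Proof.
move=> t1 tu uT.
have hd (v : R) : t <= v <= u -> is_derive v 1 s (h v).
  move=> /andP[tv vu]; apply: sh; first exact: lt_le_trans tv.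
  by apply: le_lt_trans uT; rewrite lee_fin.
have [v||v] := @MVT_segment R s h t u (ltW tu).
- by rewrite in_itv/= => /andP[a1 b1]; apply: hd; rewrite !ltW.
- exact: is_derive_segment_continuous hd.
rewrite in_itv/= => /andP[tv vu] E; rewrite -subr_gt0 E mulr_gt0 ?subr_gt0//.
apply: h0; first exact: lt_le_trans tv.
by apply: le_lt_trans uT; rewrite lee_fin.
Qed.

Lemma clock_inj (t u : R) : -1 < t -> (t%:E < T)%E -> -1 < u -> (u%:E < T)%E ->
  s t = s u -> t = u.
Proof.
move=> t1 tT u1 uT E; have [tu|ut|//] := ltgtP t u.
- by have := clock_incr t1 tu uT; rewrite E ltxx.
- by have := clock_incr u1 ut tT; rewrite E ltxx.
Qed.

Lemma clock_inverse : s 0 = 0 ->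
  (forall S : R, exists2 b, lifespan T b & S < s b) ->
  exists tau : R -> R, forall sigma, 0 <= sigma ->
    [/\ lifespan T (tau sigma), s (tau sigma) = sigma &
        is_derive sigma 1 tau (h (tau sigma))^-1].
Proof.
move=> s0 unbounded.
(* Admitting negative times lets [tau] invert [s] on both sides of 0 as well. *)
pose tau sigma := get [set t | [/\ -1 < t, (t%:E < T)%E & s t = sigma]].
have tauK (t : R) : -1 < t -> (t%:E < T)%E -> tau (s t) = t.
  move=> t1 tT.
  have [v1 vT E] : [set v | [/\ -1 < v, (v%:E < T)%E & s v = s t]] (tau (s t)).
    exact: (@getI _ _ t).
  exact: clock_inj.
exists tau => sigma sg0.
have [t [t0 tT] <-] : exists2 t, lifespan T t & s t = sigma.
  have [b [b0 bT] sb] := unbounded sigma.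
  have hd (v : R) : 0 <= v <= b -> is_derive v 1 s (h v).
    move=> /andP[v0 vb]; apply: sh; first exact: lt_le_trans v0.
    by apply: le_lt_trans bT; rewrite lee_fin.
  have [] := @IVT R s 0 b sigma b0 (is_derive_segment_continuous hd).
    by rewrite s0 ge_min le_max sg0 (ltW sb) orbT.
  move=> t; rewrite in_itv/= => /andP[t0 tb] st; exists t => //; split=> //.
  by apply: le_lt_trans bT; rewrite lee_fin.
have t1 : -1 < t by exact: lt_le_trans t0.
rewrite tauK//; split=> //.
have [u tu uT] := lifespan_room tT.
have tin : \forall v \near t, v \in `]-1, u[.
  by apply: near_in_itvoo; rewrite in_itv/= t1.
have vT (v : R) : v \in `]-1, u[ -> -1 < v /\ (v%:E < T)%E.
  rewrite in_itv/= => /andP[v1 vu]; split=> //.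
  by apply: lt_trans uT; rewrite lte_fin.
apply: is_derive_inverse.
- by apply: filterS tin => v /vT[v1 v2]; exact: tauK.
- apply: filterS tin => v /vT[v1 v2]; exact: is_derive_continuous (sh v1 v2).
- exact: sh.
- by rewrite gt_eqF// h0.
Qed.

End Clock.

(** Up to [t1] the curve is bounded by compactness, afterwards by its closeness to [l]. *)
Lemma lifespan_bounded (R : realType) (d : nat) (T : \bar R)
    (X : R -> 'rV[R]_d) (l : 'rV[R]_d) :
  (forall t, lifespan T t -> {for t, continuous X}) ->
  (exists2 t1, lifespan T t1 & forall t, lifespan T t -> t1 <= t -> `|l - X t| < 1) ->
  exists2 K : R, 0 <= K & forall t, lifespan T t -> `|X t| <= K.
Proof.
move=> Xc [t1 [t10 t1T] h1].
have [c _ hc] : exists2 c, c \in `[0, t1] & forall t, t \in `[0, t1] -> `|X t| <= `|X c|.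
  apply: (@EVT_max R (fun t => `|X t|)) => //.
  apply: continuous_in_subspaceT => t; rewrite inE/= in_itv/= => /andP[t0 tt1].
  apply: (@continuous_comp _ _ _ X (fun z => `|z|)).
    by apply: Xc; split=> //; apply: le_lt_trans t1T; rewrite lee_fin.
  exact: norm_continuous.
exists (`|X c| + (`|l| + 1)) => [|t [t0 tT]]; first by rewrite !addr_ge0.
have [tt1|t1t] := leP t t1.
  by apply: (@le_trans _ _ `|X c|); [apply: hc; rewrite in_itv/= t0|rewrite lerDl addr_ge0].
have := ler_normB l (l - X t).
have -> : l - (l - X t) = X t by rewrite opprB addrC subrK.
have := h1 t (conj t0 tT) (ltW t1t).
have := normr_ge0 (X c); lra.
Qed.

Lemma enorm_gt0 (R : realType) (d : nat) (v : 'rV[R]_d) : v != 0 -> 0 < enorm v.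
Proof. by move=> v0; rewrite sqrtr_gt0; exact: sqnorm_gt0. Qed.

Lemma enorm_gradient_continuous (R : realType) (d : nat) (f : 'rV[R]_d -> R) :
  classC2 f -> continuous (fun z => enorm (gradient f z)).
Proof.
move=> hf z.
apply: (@continuous_comp _ _ _ (fun z => \sum_i gradient f z 0 i ^+ 2) Num.sqrt);
  last exact: sqrt_continuous.
move: z; apply: continuous_big => [|i _]; first exact: add_continuous.
move=> z; apply: (@continuous_comp _ _ _ (fun z => gradient f z 0 i) (fun a => a ^+ 2));
  last exact: exprn_continuous.
have -> : (fun z => gradient f z 0 i) = partial i f.
  by apply/funext => y; rewrite mxE.
exact: (hf.1.2 i z).
Qed.

(** In the new time the velocity is minus the gradient, which is Lipschitz on bounded sets and
    vanishes at [xs]. The distance to [xs] therefore decays at most exponentially, so convergence to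
    [xs] takes infinite new time, even if [T] is finite. *)
Lemma ngd_trapped (R : realType) (d : nat) (f : 'rV[R]_d -> R)
    (xs x0 : 'rV[R]_d) (T : \bar R) (x : R -> 'rV[R]_d) (r : R) :
  classC2 f -> critical f xs -> ngd_solution f x0 T x ->
  x @ to_end T --> xs -> 0 < r -> trapped f xs r x0.
Proof.
move=> hf crit [T0 x0E [dx [_ hdx]]] lim r0.
pose X := extend_left x (dx 0).
have XE (t : R) : 0 <= t -> X t = x t by move=> t0; rewrite /X /extend_left ltNge t0.
have DX (t : R) : lifespan T t -> is_derive t 1 X (dx t).
  by move=> It; have [hd _ _] := hdx t It; exact: (@extend_left_derive _ _ T x dx).
have Xc (t : R) : lifespan T t -> {for t, continuous X}.
  by move=> It; exact: is_derive_continuous (DX t It).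
have I0 : lifespan T 0 by split; [exact: lexx|exact: T0].
have close (e : R) : 0 < e -> exists2 t1, lifespan T t1 &
    forall t, lifespan T t -> t1 <= t -> `|xs - X t| < e.
  move=> e0; have [t1 It1 h] := cvg_to_end T0 lim e0; exists t1 => // t It.
  by rewrite XE; [exact: h|case: It].
have [K K0 XK] := lifespan_bounded Xc (close 1 ltr01).
(* The rate is continued to negative times by its value at 0, which keeps it positive and continuous
   there. *)
pose h t := (enorm (gradient f (X (Num.max 0 t))))^-1.
have Imax (t : R) : (t%:E < T)%E -> lifespan T (Num.max 0 t).
  by move=> tT; split; [rewrite le_max lexx|case: (leP 0 t)].
have gpos (t : R) : lifespan T t -> 0 < enorm (gradient f (X t)).
  move=> It; have [_ g0 _] := hdx t It; rewrite XE; last by case: It.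
  exact: enorm_gt0.
have hc (t : R) : (t%:E < T)%E -> {for t, continuous h}.
  move=> tT.
  have gc : {for t, continuous (fun t : R => enorm (gradient f (X (Num.max 0 t))))}.
    apply: (@continuous_comp _ _ _ (fun t : R => X (Num.max 0 t))
      (fun z => enorm (gradient f z))); last exact: enorm_gradient_continuous.
    apply: (@continuous_comp _ _ _ (fun t : R => Num.max 0 t) X); last exact: Xc (Imax _ tT).
    by apply: (@continuous_max _ R (cst 0) id); [exact: cst_continuous|].
  by apply: cvgV gc; rewrite gt_eqF// gpos//; exact: Imax.
have hpos (t : R) : (t%:E < T)%E -> 0 < h t.
  by move=> tT; rewrite invr_gt0 gpos//; exact: Imax.
have hE (t : R) : lifespan T t -> h t = (enorm (gradient f (X t)))^-1.
  by move=> [t0 _]; rewrite /h max_r.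
have dxE (t : R) : lifespan T t -> dx t = - (h t *: gradient f (X t)).
  by move=> It; have [_ _ ->] := hdx t It; rewrite hE// XE//; case: It.
have [s s0 sh] := primitive hc.
have spos (t : R) : -1 < t -> (t%:E < T)%E -> 0 < h t by move=> _; exact: hpos.
have [L L0 lip] := gradient_lipschitz hf (addr_ge0 K0 (normr_ge0 xs)).
pose k := 2 * d%:R * L; have k0 : 0 <= k by rewrite !mulr_ge0.
(* The initial point is not [xs], because its gradient is nonzero. *)
have N0 : 0 < sqnorm (X 0 - xs).
  apply: sqnorm_gt0; rewrite subr_eq0; apply: contraTneq (gpos 0 I0) => ->.
  rewrite crit -leNgt /enorm big1 ?sqrtr0// => i _.
  by rewrite mxE expr0n.
(* Backward Gronwall with the primitive [k * s]: the decay is measured in the new time. *)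
have escape (b : R) : lifespan T b ->
    sqnorm (X 0 - xs) <= expR (k * s b) * sqnorm (X b - xs).
  move=> [b0 bT].
  have Ib (t : R) : 0 <= t <= b -> lifespan T t.
    by move=> /andP[t0 tb]; split=> //; apply: le_lt_trans bT; rewrite lee_fin.
  have hu (t : R) : 0 <= t <= b ->
      is_derive t 1 (fun s => bform 1%:M (X s - xs) (X s - xs))
        (2 * bform 1%:M (X t - xs) (dx t)).
    move=> /Ib It; apply: is_derive_bform; first exact: trmx1.
    move=> i; have hi := is_derive_coord i (DX t It).
    have -> : (fun s => (X s - xs) 0 i) = (fun s => X s 0 i) - cst (xs 0 i).
      by apply/funext => u; rewrite !mxE.
    by apply: is_derive_eq (is_deriveB hi (is_derive_cst _ _ _)) _; rewrite subr0.
  have hk (t : R) : 0 <= t <= b -> is_derive t 1 (fun t => k * s t) (k * h t).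
    move=> /andP[t0 tb]; have [_ tT] := Ib t (introT andP (conj t0 tb)).
    have sd := sh t (lt_le_trans (ltrN10 R) t0) tT.
    exact: (@is_deriveZ _ _ _ s k t 1 _ sd).
  have := gronwall_ge b0 hu hk; rewrite -!sqnorm_bform s0 mulr0 subr0.
  apply=> t /Ib It; have ht : 0 < h t by apply: hpos; case: It.
  suff : `|bform 1%:M (X t - xs) (dx t)| <= d%:R * L * h t * sqnorm (X t - xs).
    rewrite -sqnorm_bform ler_norml => /andP[+ _]; rewrite /k; lra.
  rewrite bform1; apply: le_trans (dot_le _ _) _.
  rewrite -!mulrA ler_wpM2l// dxE// normrN normrZ gtr0_norm//.
  have -> : gradient f (X t) = gradient f (X t) - gradient f xs.
    by rewrite crit subr0.
  apply: (@le_trans _ _ (`|X t - xs| * (h t * (L * `|X t - xs|)))).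
    rewrite ler_wpM2l// ler_wpM2l ?(ltW ht)// lip//.
      by apply: le_trans (XK t It) _; rewrite lerDl.
    by rewrite lerDr.
  rewrite (_ : _ * (h t * _) = L * (h t * `|X t - xs| ^+ 2)); last by ring.
  by rewrite ler_wpM2l// ler_wpM2l ?(ltW ht)// sqr_norm_le_sqnorm.
have unbounded (S : R) : exists2 b, lifespan T b & S < s b.
  pose c := sqnorm (X 0 - xs) * expR (- (k * S)).
  have c0 : 0 < c by rewrite mulr_gt0// expR_gt0.
  (* As [e <= 1], the squared distance is at most [d%:R * e], which is below [c]. If [s b <= S]
     held, this would contradict [escape]. *)
  pose e := Num.min 1 (c / (d%:R + 1)).
  have d1 : 0 < d%:R + 1 :> R by rewrite ltr_wpDl.
  have e0 : 0 < e by rewrite lt_min ltr01 divr_gt0.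
  have [b Ib hb] := close e e0; exists b => //.
  rewrite ltNge; apply/negP => sbS.
  have Nb : sqnorm (X b - xs) < c.
    apply: le_lt_trans (sqnorm_le _) _.
    have xb : `|X b - xs| <= e by rewrite distrC ltW// hb.
    apply: (@le_lt_trans _ _ (d%:R * e)).
      rewrite ler_wpM2l// expr2 -[leRHS]mul1r ler_pM//.
      by apply: le_trans xb _; rewrite ge_min lexx.
    apply: (@le_lt_trans _ _ (d%:R * (c / (d%:R + 1)))).
      by rewrite ler_wpM2l// ge_min lexx orbT.
    by rewrite mulrA ltr_pdivrMr// mulrC ltr_pM2l// ltrDl.
  have := escape b Ib; apply/negP; rewrite -ltNge.
  apply: (@le_lt_trans _ _ (expR (k * S) * sqnorm (X b - xs))).
    by rewrite ler_wpM2r ?sqnorm_ge0// ler_expR ler_wpM2l.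
  apply: (@lt_le_trans _ _ (expR (k * S) * c)); first by rewrite ltr_pM2l ?expR_gt0.
  by rewrite /c mulrCA -expRD subrr expR0 mulr1.
have [tau htau] := clock_inverse sh spos s0 unbounded.
have tau0 : tau 0 = 0.
  have [[a1 a2] a3 _] := htau 0 (lexx 0).
  apply: (clock_inj sh spos (lt_le_trans (ltrN10 R) a1) a2 (ltrN10 R) T0).
  by rewrite a3 s0.
exists (fun sigma => X (tau sigma)); split.
- move=> sigma sg0 i; have [It st dtau] := htau sigma sg0.
  have hX := is_derive_coord i (DX _ It).
  apply: is_derive_eq (@is_derive1_comp _ (fun t => X t 0 i) tau _ _ _ hX dtau) _.
  rewrite dxE// !mxE mulNr mulrAC divff ?mul1r//.
  by rewrite gt_eqF// hpos//; case: It.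
- by rewrite tau0 XE// x0E.
- by exists K => sigma /htau[It _ _]; exact: XK.
(* Since [s] is increasing, new times beyond [s t1] correspond to old times beyond [t1]. *)
- have [t1 [t10 t1T] h1] := close r r0; exists (Num.truncn (s t1)).+1 => sigma sgn.
  have sg0 : 0 <= sigma by apply: le_trans sgn.
  have [[a1 a2] a3 _] := htau sigma sg0.
  rewrite -ball_normE /=; apply: h1 => //; rewrite leNgt; apply/negP => tt1.
  have := clock_incr sh spos (lt_le_trans (ltrN10 R) a1) tt1 t1T.
  rewrite a3 => sg1.
  by have := lt_trans (lt_le_trans (truncnS_gt (s t1)) sgn) sg1; rewrite ltxx.
Qed.

(** * Saddles *)

(** With [w = v *m H], a small step from [v] against [w] keeps the form nonnegative, whence the form
    at [v] is at least [t * sqnorm w]; invertibility bounds [v] by [w]. *)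
Lemma psd_coercive (R : realType) (d : nat) (H : 'M[R]_d) :
  H^T = H -> H \in unitmx -> (forall v, 0 <= bform H v v) ->
  exists2 m : R, 0 < m & forall v, m * `|v| ^+ 2 <= bform H v v.
Proof.
move=> HT Hu H0; have [B B0 hB] := bform_bounded H.
have [C C0 hC] := mulmx_bounded (invmx H).
pose t := (B + 1)^-1; have B1 : 0 < B + 1 by rewrite ltr_wpDl.
have t0 : 0 < t by rewrite invr_gt0.
have C1 : 0 < C + 1 by rewrite ltr_wpDl.
exists (t / (C + 1) ^+ 2) => [|v]; first by rewrite divr_gt0// exprn_gt0.
set w := v *m H.
have vw : `|v| <= (C + 1) * `|w|.
  by apply: le_trans (_ : C * `|w| <= _); [rewrite -{1}(mulmxK Hu v) hC|rewrite ler_wpM2r// lerDl].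
(* Positivity of the form at v - t (v H) bounds it below at v. *)
have := H0 (v + (- t) *: w).
rewrite !bformDl !bformDr !bformZl !bformZr (bform_sym w v HT).
have -> : bform H v w = sqnorm w.
  by rewrite /bform -/w; apply: eq_bigr => j _; rewrite expr2.
have : bform H w w <= B * sqnorm w.
  apply: le_trans (ler_norm _) _; apply: le_trans (hB _ _) _.
  by rewrite ler_wpM2l// -expr2 sqr_norm_le_sqnorm.
move=> /(ler_wpM2l (ltW t0)) h1 h2.
have tB : t * B <= 1 by rewrite /t mulrC ler_pdivrMr// mul1r lerDl.
have h3 : t * B * sqnorm w <= sqnorm w by rewrite ler_piMl// sqnorm_ge0.
have h4 : t * bform H w w <= sqnorm w by lra.
have h5 : t * (t * bform H w w) <= t * sqnorm w by rewrite ler_pM2l.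
have h6 : t * sqnorm w <= bform H v v by lra.
apply: le_trans h6; rewrite -mulrA ler_pM2l//.
apply: le_trans (sqr_norm_le_sqnorm w).
rewrite mulrC ler_pdivrMr ?exprn_gt0// mulrC -exprMn.
by rewrite lerXn2r ?nnegrE// mulr_ge0// ltW.
Qed.

(** The mean value theorem gives [f y - f x0] as the gradient at [p = x0 + t *: z] paired with [z].
    Linearizing this gradient at [x0] yields [t] times the form at [z], with an error also
    proportional to [t], so coercivity absorbs it. *)
Lemma critical_psd_local_min (R : realType) (d : nat) (f : 'rV[R]_d -> R)
    (x0 : 'rV[R]_d) : classC2 f -> critical f x0 -> nondegenerate_at f x0 ->
  (forall v, 0 <= bform (hessian f x0) v v) -> local_min f x0.
Proof.
move=> hf crit; rewrite /nondegenerate_at; set H := hessian f x0 => Hu H0.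
have HT : H^T = H by apply/matrixP => i j; rewrite !mxE; exact: hessian_sym.
have [m m0 hm] := psd_coercive HT Hu H0.
pose e := m / (d%:R * d%:R + 1).
have D0 : 0 < d%:R * d%:R + 1 :> R by rewrite ltr_wpDl// mulr_ge0.
have e0 : 0 < e by rewrite divr_gt0.
have [r r0 hr] := partial_linearization x0 hf e0.
apply/nbhs_ballP; exists r => //= y yr; rewrite -subr_ge0.
have [t /andP[t0 t1] ->] := partial_mvt hf.1.1 y x0.
set z := y - x0; set p := x0 + t *: z.
have pr : ball x0 r p.
  move: yr; rewrite -!ball_normE/= => yr.
  rewrite /p opprD addrA subrr add0r normrN normrZ ger0_norm//.
  apply: le_lt_trans yr; rewrite -normrN opprB -/z.
  by rewrite -[leRHS]mul1r ler_wpM2r.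
pose E := gradient f p - gradient f x0 - (p - x0) *m H.
have hE : `|E| <= d%:R * e * `|p - x0|.
  apply: rV_norm_le => [|j]; first by rewrite !mulr_ge0// ltW.
  by have := hr p x0 j pr (ballxx _ r0); rewrite /E !mxE.
have px : p - x0 = t *: z by rewrite /p addrC addKr.
have -> : \sum_i z 0 i * partial i f p = t * bform H z z + \sum_i z 0 i * E 0 i.
  rewrite /bform mulr_sumr -big_split; apply: eq_bigr => i _ /=.
  have -> : partial i f p = gradient f p 0 i by rewrite mxE.
  have -> : gradient f p = E + t *: (z *m H).
    by rewrite /E px crit subr0 -scalemxAl subrK.
  have -> : (E + t *: (z *m H)) 0 i = E 0 i + t * (z *m H) 0 i.
    by rewrite mxE; congr (_ + _); rewrite mxE.
  by ring.
have := le_trans (dot_le z E) _ => /(_ (d%:R * (`|z| * (d%:R * e * `|p - x0|)))).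
have -> : `|p - x0| = t * `|z| by rewrite px normrZ ger0_norm.
rewrite px normrZ ger0_norm// in hE.
rewrite ler_wpM2l// ?ler_wpM2l// => /(_ isT).
have -> : d%:R * (`|z| * (d%:R * e * (t * `|z|))) = (t * `|z| ^+ 2) * (e * (d%:R * d%:R)).
  by ring.
have em : e * (d%:R * d%:R) <= m.
  by rewrite /e mulrAC ler_pdivrMr// ler_pM2l// lerDl.
have tz : 0 <= t * `|z| ^+ 2 by rewrite mulr_ge0.
move=> /ler_normlP[h1 _].
have h2 := ler_wpM2l tz em; have h3 := ler_wpM2l t0 (hm z).
lra.
Qed.

Lemma trapped_sub (R : realType) (d : nat) (f : 'rV[R]_d -> R)
    (c c' : 'rV[R]_d) (r r' : R) :
  ball c r `<=` ball c' r' -> trapped f c r `<=` trapped f c' r'.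
Proof.
move=> sub a [y [gy y0 yK [n yn]]]; exists y; split=> //.
by exists n => t nt; apply: sub; exact: yn.
Qed.

Lemma lebesgue_null_set0 (R : realType) (d : nat) :
  lebesgue_null (set0 : set 'rV[R]_d).
Proof.
apply/lebesgue_nullP => e e0; exists xpred0, (fun=> 0), (fun=> 0); split=> //.
by rewrite eseries_pred0 // lee_fin ltW.
Qed.

Lemma rational_near (R : realType) (d : nat) (x : 'rV[R]_d) (e : R) : 0 < e ->
  exists q : 'rV[rat]_d, `|x - map_mx ratr q| <= e.
Proof.
move=> e0.
have /choice[q hq] : forall i, exists q : rat, `|x 0 i - ratr q| <= e.
  move=> i; have [|q] := @rat_in_itvoo R (x 0 i - e) (x 0 i + e); first lra.
  by rewrite in_itv/= => /andP[q1 q2]; exists q; rewrite ler_norml; lra.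
exists (\row_i q i); apply: rV_norm_le => [|i]; first exact: ltW.
by rewrite !mxE.
Qed.

(* A countable union is extracted from the uncountable one by means of the balls
   with rational centres and radii 1/(n+1). *)
Lemma lebesgue_null_trapped_union (R : realType) (d : nat) (f : 'rV[R]_d -> R)
    (S : set 'rV[R]_d) :
  (forall c, S c -> exists2 r : R, 0 < r & lebesgue_null (trapped f c r)) ->
  lebesgue_null [set a | exists c, S c /\ forall r : R, 0 < r -> trapped f c r a].
Proof.
move=> hS.
pose B (p : 'rV[rat]_d * nat) := trapped f (map_mx ratr p.1) (p.2.+1%:R^-1 : R).
(* Codes of no pair, and of balls whose trapped set is not null, contribute the empty set. *)
pose A k := [set a | exists p, [/\ unpickle k = Some p, lebesgue_null (B p) & B p a]].
apply: (@lebesgue_null_sub _ _ _ (\bigcup_k A k)); last first.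
  apply: lebesgue_null_bigcup => k.
  case E : (unpickle k) => [p|]; last first.
    by apply: lebesgue_null_sub (lebesgue_null_set0 _ _) => a [p []]; rewrite E.
  have [Bp|nBp] := pselect (lebesgue_null (B p)).
    by apply: lebesgue_null_sub Bp => a [p' []]; rewrite E => -[<-].
  apply: lebesgue_null_sub (lebesgue_null_set0 _ _) => a [p' []].
  by rewrite E => -[<-].
move=> a [c [Sc ca]]; have [r r0 cr] := hS c Sc.
(* With [2 * rho < r] and a rational centre within [rho / 2] of [c], the rational ball of radius
   [rho] lies inside [ball c r] and contains [ball c (rho / 2)]. *)
pose n := Num.truncn (2 / r); pose rho : R := n.+1%:R^-1.
have rho0 : 0 < rho by rewrite invr_gt0.
have rhor : 2 * rho < r.
  rewrite /rho ltr_pdivrMr// mulrC -ltr_pdivrMr//; exact: truncnS_gt.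
have [q cq] := rational_near c (divr_gt0 rho0 (ltr0n R 2)).
exists (pickle (q, n)) => //; exists (q, n); rewrite pickleK; split=> //.
- apply: lebesgue_null_sub cr; apply: trapped_sub => z; rewrite -!ball_normE/=.
  move=> h; have := ler_distD (map_mx ratr q) c z; rewrite -/rho in h.
  lra.
- apply: trapped_sub (ca _ (divr_gt0 rho0 (ltr0n R 2))) => z.
  rewrite -!ball_normE/= => h; have := ler_distD c (map_mx ratr q) z.
  rewrite -/rho [`|_ - c|]distrC; lra.
Qed.

Lemma reaching_trapped (R : realType) (d : nat) (f : 'rV[R]_d -> R)
    (c a : 'rV[R]_d) (r : R) :
  classC2 f -> critical f c -> reaching_set f c a -> 0 < r -> trapped f c r a.
Proof. by move=> hf crit [T [x [[sol _] lim]]]; exact: ngd_trapped sol lim. Qed.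

Unset Implicit Arguments.

Theorem theorem9 (R : realType) (d : nat) (f : 'rV[R]_d -> R) (hf : classC2 f) :
  (forall xstar : 'rV[R]_d, saddle f xstar ->
     (exists lambda : R, eigenvalue (hessian f xstar) lambda /\ lambda < 0) ->
     lebesgue_null (reaching_set f xstar)) /\
  ((forall xstar : 'rV[R]_d, saddle f xstar -> nondegenerate_at f xstar) ->
   lebesgue_null [set x0 : 'rV[R]_d |
     exists xstar : 'rV[R]_d, saddle f xstar /\ reaching_set f xstar x0]).
Proof.
split=> [xstar [crit _ _] [lambda [/eigenvalueP[v vH v0] l0]]|nondeg].
  (* An eigenvector for [lambda] serves as the direction of negative curvature. *)
  have Hv : bform (hessian f xstar) v v < 0.
    have -> : bform (hessian f xstar) v v = lambda * sqnorm v.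
      rewrite /bform vH mulr_sumr; apply: eq_bigr => j _.
      by rewrite mxE -mulrA expr2.
    by rewrite nmulr_rlt0// sqnorm_gt0.
  have [r r0 null] := trapped_null hf Hv.
  by apply: lebesgue_null_sub null => a ha; exact: reaching_trapped ha r0.
apply: (@lebesgue_null_sub _ _ _
  [set a | exists c, saddle f c /\ forall r : R, 0 < r -> trapped f c r a]).
  move=> a [c [sc ha]]; exists c; split=> // r; have [crit _ _] := sc.
  exact: reaching_trapped ha.
apply: lebesgue_null_trapped_union => c sc; have [crit nmin _] := sc.
have [v Hv] : exists v, bform (hessian f c) v v < 0.
  apply: contrapT => /forallNP nv; apply: nmin.
  apply: critical_psd_local_min => // [|v]; first exact: nondeg.
  by rewrite leNgt; apply/negP; exact: nv.
exact: trapped_null Hv.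
Qed.
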